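(* Let $p$ be a prime and $n$ even. Alice holds $x'\in\mathbb{F}_p^{(n/2)\times n}$ and Bob holds $y'\in\mathbb{F}_p^{(n/2)\times n}$, and let $z=\begin{pmatrix}x'\\ y'\end{pmatrix}\in M_n(\mathbb{F}_p)$ be the stacked matrix. Any (bounded-error) quantum communication protocol requires $\Omega(n^2\log p)$ qubits of communication to solve each of the following: (i) $\textsc{Rank}'_{n,n-1}$: under the promise $\mathrm{rk}(z)\in\{n-1,n\}$, decide which holds; (ii) $\textsc{Inverse}'$: under the promise that $z$ is invertible, decide whether the top-left entry of $z^{-1}$ is zero; (iii) $\textsc{SolveLinearSystem}'_b$: for a fixed non-zero $b\in\mathbb{F}_p^n$, under the promise that $z$ is invertible, decide whether the first coordinate $t_1$ of the solution $t\in\mathbb{F}_p^n$ of $zt=b$ is zero.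
   Context: Quantum two-party communication model: Alice and Bob exchange qubits and must produce the correct answer with bounded error on every input satisfying the promise; cost is the number of qubits exchanged. Since randomized protocols are special cases, this also lower-bounds randomized communication. *)

(* Defs.v *)
From mathcomp Require Export all_boot all_order all_algebra.
From mathcomp Require Export complex reals exp.

Set Implicit Arguments.
Unset Strict Implicit.
Unset Printing Implicit Defensive.

Import Order.TTheory GRing.Theory Num.Theory.
Local Open Scope ring_scope.
Local Open Scope sesquilinear_scope.

Section Protocols.
Variable R : realType.
Local Notation C := R[i].

Definition isometry m n (V : 'M[C]_(m, n)) : Prop := V^t* *m V = 1%:M.

(* A pure state of C^a (x) C^b (Alice (x) Bob) is represented by its a x b
   matrix of amplitudes [psi]: an operator [V] on Alice's side acts as
   [V *m psi] and an operator [W] on Bob's side as [psi *m W^T].  A composite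
   register C^m (x) C^q has the basis vectors [mxvec_index i s]. *)
Definition sqnorm m n (psi : 'M[C]_(m, n)) : R :=
  \sum_i \sum_j ComplexField.Normc.normc (psi i j) ^+ 2.

(* (C^a (x) C^q) (x) C^b seen as C^a (x) (C^q (x) C^b), and conversely:
   the middle register changes hands and the amplitudes are unchanged. *)
Definition hand_to_bob a q b (psi : 'M[C]_(a * q, b)) : 'M[C]_(a, q * b) :=
  \matrix_(i, l)
    mxvec (\matrix_(s < q, j < b) psi (mxvec_index i s) j) 0 l.

Definition hand_to_alice a q b (psi : 'M[C]_(a, q * b)) : 'M[C]_(a * q, b) :=
  \matrix_(l, j)
    mxvec (\matrix_(i < a, s < q) psi i (mxvec_index s j)) 0 l.

Lemma hand_to_bobE a q b (psi : 'M[C]_(a * q, b)) i s j :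
  hand_to_bob psi i (mxvec_index s j) = psi (mxvec_index i s) j.
Proof. by rewrite mxE mxvecE mxE. Qed.

Lemma hand_to_aliceE a q b (psi : 'M[C]_(a, q * b)) i s j :
  hand_to_alice psi (mxvec_index i s) j = psi i (mxvec_index s j).
Proof. by rewrite mxE mxvecE mxE. Qed.

Variables X Y : Type.

(* [interaction a b]: what remains of a protocol when the players hold
   registers of dimensions [a] and [b].  In each step one player, knowing only
   her or his own input, applies an isometry (a unitary after adjoining fresh
   ancillas) and passes [k] qubits to the other player.  At the end one player
   applies an isometry onto (workspace (x) C^2), measures the qubit C^2 in the
   computational basis and outputs the outcome.  Intermediate measurements and
   noisy operations are covered by deferring them to ancillas.  Who moves and
   the message lengths do not depend on the inputs. *)
Inductive interaction : nat -> nat -> Type :=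
| AliceSends a b k a' (V : X -> 'M[C]_(a' * 2 ^ k, a)) :
    (forall x, isometry (V x)) ->
    interaction a' (2 ^ k * b) -> interaction a b
| BobSends a b k b' (W : Y -> 'M[C]_(2 ^ k * b', b)) :
    (forall y, isometry (W y)) ->
    interaction (a * 2 ^ k) b' -> interaction a b
| AliceOutputs a b a' (V : X -> 'M[C]_(a' * 2, a)) :
    (forall x, isometry (V x)) -> interaction a b
| BobOutputs a b b' (W : Y -> 'M[C]_(2 * b', b)) :
    (forall y, isometry (W y)) -> interaction a b.

Fixpoint qubits_sent a b (P : interaction a b) : nat :=
  match P with
  | AliceSends _ _ k _ _ _ P' => (k + qubits_sent P')%N
  | BobSends _ _ k _ _ _ P' => (k + qubits_sent P')%N
  | AliceOutputs _ _ _ _ _ | BobOutputs _ _ _ _ _ => 0%N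
  end.

(* Probability of the outcome 1 (the second basis vector of C^2), starting
   from the joint state given as last argument. *)
Fixpoint prob_one a b (P : interaction a b) (x : X) (y : Y) :
    'M[C]_(a, b) -> R :=
  match P in interaction a b return 'M[C]_(a, b) -> R with
  | AliceSends _ _ _ _ V _ P' => fun psi =>
      prob_one P' x y (hand_to_bob (V x *m psi))
  | BobSends _ _ _ _ W _ P' => fun psi =>
      prob_one P' x y (hand_to_alice (psi *m (W y)^T))
  | AliceOutputs _ _ _ V _ => fun psi =>
      sqnorm (\matrix_(i, j) (V x *m psi) (mxvec_index i ord_max) j)
  | BobOutputs _ _ _ W _ => fun psi =>
      sqnorm (\matrix_(i, j) (psi *m (W y)^T) i (mxvec_index ord_max j))
  end.

(* The initial joint state is an arbitrary input-independent unit vector, so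
   prior entanglement and shared randomness are allowed; protocols without them
   are those whose initial state is a product state. *)
Record protocol := Protocol {
  dimA : nat;
  dimB : nat;
  initial_state : 'M[C]_(dimA, dimB);
  initial_state_unit : sqnorm initial_state = 1;
  run : interaction dimA dimB
}.

Definition cost (P : protocol) : nat := qubits_sent (run P).

Definition accept_prob (P : protocol) (x : X) (y : Y) : R :=
  prob_one (run P) x y (initial_state P).

Definition solves (eps : R) (P : protocol) (promise answer : X -> Y -> Prop) :
    Prop :=
  forall x y, promise x y ->
    (answer x y -> 1 - eps <= accept_prob P x y) /\
    (~ answer x y -> accept_prob P x y <= eps).

End Protocols.

(* Half-dimension [m.+1], so that [n = m.+1 + m.+1] is an arbitrary positive
   even number and the coordinates have a first index. *)
Section Problems.
Variables (F : fieldType) (m : nat).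
Local Notation n := (m.+1 + m.+1)%N.
Implicit Types x y : 'M[F]_(m.+1, n).

Definition first_idx : 'I_n := lshift m.+1 ord0.

Definition stack x y : 'M[F]_n := col_mx x y.

Definition rank_promise x y : Prop :=
  \rank (stack x y) = n.-1 \/ \rank (stack x y) = n.

Definition rank_answer x y : Prop := \rank (stack x y) = n.

Definition invertible_promise x y : Prop := stack x y \in unitmx.

Definition inverse_answer x y : Prop :=
  invmx (stack x y) first_idx first_idx = 0.

(* Under the promise the solution [t] exists and is unique. *)
Definition linear_system_answer (b : 'cV[F]_n) x y : Prop :=
  exists t : 'cV[F]_n, stack x y *m t = b /\ t first_idx 0 = 0.

End Problems.

(* Main.v *)
(** Write [q] for the order of the prime field and let a protocol send [t]
    qubits.  Its final state is a sum of [2 ^ t] terms [A_j(x) psi B_j(y)^T] with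
    contractions [A_j], [B_j], so its acceptance probability [a(x, y)] is an inner
    product of vectors of squared length at most [4 ^ t].  If
    [H(T) = sum_M w(M) chi(tr(M T))] with [|w| <= 1], Parseval then gives
    [|sum_(x, y) H(x + y) a(x, y)| <= N ^ 2 * 4 ^ t], where [N] is the number of
    matrices [T].

    Such an [H] of large l1 norm is built by bordering.  For [T = (e d; c Z)] put
    [border G T = G(Z) * q ^ (k l) * sum_(X | Z X = c) (q [tr e = tr(d X)] - 1)].
    Completing the square in the Fourier integral shows that coefficients bounded
    by 1 stay so.  For invertible [Z] the sum is positive or negative according to
    whether [tr e = tr(d Z^-1 c)], and it vanishes unless the rows of [d] lie in
    the row space of [Z], which for [l] rows damps a singular [Z] by
    [q ^ - (l * corank Z)].  Iterating with [l = 1], starting from the constant 1,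
    gives a witness whose mass on singular matrices, weighted in this way, is at
    most [4 / 2 ^ l] times its mass on invertible ones.  A last border of constant
    width [l] is therefore concentrated on the inputs with [Z] invertible, and
    [4 ^ t] is at least a constant times [q ^ 'C(k, 2)] for every protocol deciding
    whether [tr e = tr(d Z^-1 c)], where [x + y = (e d; c Z)].

    This additive problem embeds into the three stacked ones: [Z] acting on
    k x l matrices is a matrix of size [k * l], and eliminating the second block
    column of [(A 1; E B - E)] leaves [A + B]. *)

Require Import Defs.
From mathcomp Require Import ring lra zify.
Set Implicit Arguments.
Unset Strict Implicit.
Unset Printing Implicit Defensive.
Import Order.TTheory GRing.Theory Num.Theory.
Local Open Scope ring_scope.
Local Open Scope sesquilinear_scope.

Lemma sum_mxvec_index (V : nmodType) m n (f : 'I_(m * n) -> V) :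
  \sum_l f l = \sum_i \sum_j f (mxvec_index i j).
Proof.
rewrite pair_bigA /=.
by rewrite (reindex _ (curry_mxvec_bij m n)); apply: eq_bigr => -[].
Qed.

(** * Contractions and composite registers *)

Section Contractions.
Variable C : numClosedFieldType.

Definition sqfrob m n (A : 'M[C]_(m, n)) : C := \sum_i \sum_j `|A i j| ^+ 2.

Lemma sqfrob_tr m n (A : 'M[C]_(m, n)) : sqfrob A = \tr (A^t* *m A).
Proof.
rewrite /sqfrob exchange_big; apply: eq_bigr => j _.
by rewrite !mxE; apply: eq_bigr => i _; rewrite !mxE normCKC.
Qed.

Lemma sqfrob_ge0 m n (A : 'M[C]_(m, n)) : 0 <= sqfrob A.
Proof. by do 2![apply: sumr_ge0 => ? _]; rewrite exprn_ge0. Qed.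

Lemma sqfrob_trmx m n (A : 'M[C]_(m, n)) : sqfrob A^T = sqfrob A.
Proof.
rewrite /sqfrob exchange_big; apply: eq_bigr => i _.
by apply: eq_bigr => j _; rewrite mxE.
Qed.

Lemma sqfrob_conj m n (A : 'M[C]_(m, n)) : sqfrob (map_mx Num.conj A) = sqfrob A.
Proof.
by apply: eq_bigr => i _; apply: eq_bigr => j _; rewrite mxE norm_conjC.
Qed.

(** Operator norm at most one. The arbitrary number of columns of [phi] lets the bound apply to an
    amplitude matrix when the operator acts on one player's side only. *)
Definition contraction m n (A : 'M[C]_(m, n)) : Prop :=
  forall k (phi : 'M[C]_(n, k)), sqfrob (A *m phi) <= sqfrob phi.

Lemma contraction_mul m n k (A : 'M[C]_(m, n)) (B : 'M[C]_(n, k)) :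
  contraction A -> contraction B -> contraction (A *m B).
Proof.
by move=> hA hB l phi; rewrite -mulmxA (le_trans (hA _ _)).
Qed.

Lemma isometry_contraction m n (A : 'M[C]_(m, n)) :
  A^t* *m A = 1%:M -> contraction A.
Proof.
move=> hA k phi; rewrite !sqfrob_tr trmx_mul map_mxM /=.
by rewrite mulmxA -(mulmxA (map_mx _ _)) hA mulmx1.
Qed.

(* Expand 0 <= |phi - A A^* phi|^2 and use |A (A^* phi)| <= |A^* phi|. *)
Lemma contraction_adj m n (A : 'M[C]_(m, n)) :
  contraction A -> contraction (A^t*).
Proof.
move=> hA k phi; have := sqfrob_ge0 (phi - A *m (A^t* *m phi)).
set chi := A^t* *m phi; have := hA _ chi.
have -> : sqfrob (phi - A *m chi) =
    sqfrob phi - sqfrob chi *+ 2 + sqfrob (A *m chi).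
  rewrite !sqfrob_tr.
  have -> : (phi - A *m chi)^t* = phi^t* - (A *m chi)^t*.
    by apply/matrixP => i j; rewrite !mxE rmorphB.
  rewrite mulmxBl !mulmxBr !raddfB /=.
  have -> : \tr (phi^t* *m (A *m chi)) = \tr (chi^t* *m chi).
    by rewrite {2}/chi trmx_mul map_mxM /= trmxCK mulmxA.
  have -> : \tr ((A *m chi)^t* *m phi) = \tr (chi^t* *m chi).
    by rewrite trmx_mul map_mxM /= -mulmxA.
  ring.
move=> h1 h2; rewrite -subr_ge0.
have -> : sqfrob phi - sqfrob chi = (sqfrob phi - sqfrob chi *+ 2 + sqfrob (A *m chi))
   + (sqfrob chi - sqfrob (A *m chi)) by ring.
by rewrite addr_ge0 // subr_ge0.
Qed.

(* [brar s A] is (I (x) <s|) A and [bral s A] is (<s| (x) I) A. *)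
Definition brar m n k (s : 'I_n) (A : 'M[C]_(m * n, k)) : 'M[C]_(m, k) :=
  \matrix_(i, j) A (mxvec_index i s) j.

Definition bral m n k (s : 'I_m) (A : 'M[C]_(m * n, k)) : 'M[C]_(n, k) :=
  \matrix_(i, j) A (mxvec_index s i) j.

Lemma brar_mul m n k l s (A : 'M[C]_(m * n, k)) (B : 'M[C]_(k, l)) :
  brar s (A *m B) = brar s A *m B.
Proof. by apply/matrixP => i j; rewrite !mxE; apply: eq_bigr => ? _; rewrite mxE. Qed.

Lemma bral_mul m n k l s (A : 'M[C]_(m * n, k)) (B : 'M[C]_(k, l)) :
  bral s (A *m B) = bral s A *m B.
Proof. by apply/matrixP => i j; rewrite !mxE; apply: eq_bigr => ? _; rewrite mxE. Qed.

Lemma sqfrob_brar m n k s (A : 'M[C]_(m * n, k)) :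
  sqfrob (brar s A) <= sqfrob A.
Proof.
rewrite /sqfrob sum_mxvec_index; apply: ler_sum => i _.
rewrite (bigD1 s) //= -[leLHS]addr0 lerD //.
  by under eq_bigr do rewrite mxE.
by do 2![apply: sumr_ge0 => ? _]; rewrite exprn_ge0.
Qed.

Lemma sqfrob_bral m n k s (A : 'M[C]_(m * n, k)) :
  sqfrob (bral s A) <= sqfrob A.
Proof.
rewrite /sqfrob sum_mxvec_index [leRHS]exchange_big; apply: ler_sum => i _.
rewrite (bigD1 s) //= -[leLHS]addr0 lerD //.
  by under eq_bigr do rewrite mxE.
by do 2![apply: sumr_ge0 => ? _]; rewrite exprn_ge0.
Qed.

Lemma contraction_brar m n k s (A : 'M[C]_(m * n, k)) :
  contraction A -> contraction (brar s A).
Proof. by move=> hA l phi; rewrite -brar_mul (le_trans (sqfrob_brar _ _)). Qed.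

Lemma contraction_bral m n k s (A : 'M[C]_(m * n, k)) :
  contraction A -> contraction (bral s A).
Proof. by move=> hA l phi; rewrite -bral_mul (le_trans (sqfrob_bral _ _)). Qed.

(* [ketl s A] is |s> (x) A and [ketr s A] is A (x) |s>. *)
Definition ketl m n k (s : 'I_m) (A : 'M[C]_(n, k)) : 'M[C]_(m * n, k) :=
  \matrix_(l, j) mxvec (\matrix_(t < m, i < n) ((t == s)%:R * A i j)) 0 l.

Definition ketr m n k (s : 'I_n) (A : 'M[C]_(m, k)) : 'M[C]_(m * n, k) :=
  \matrix_(l, j) mxvec (\matrix_(i < m, t < n) ((t == s)%:R * A i j)) 0 l.

Lemma ketlE m n k (s : 'I_m) (A : 'M[C]_(n, k)) t i j :
  ketl s A (mxvec_index t i) j = (t == s)%:R * A i j.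
Proof. by rewrite mxE mxvecE mxE. Qed.

Lemma ketrE m n k (s : 'I_n) (A : 'M[C]_(m, k)) t i j :
  ketr s A (mxvec_index i t) j = (t == s)%:R * A i j.
Proof. by rewrite mxE mxvecE mxE. Qed.

Lemma ketl_mul m n k l (s : 'I_m) (A : 'M[C]_(n, k)) (B : 'M[C]_(k, l)) :
  ketl s (A *m B) = ketl s A *m B.
Proof.
apply/matrixP => r j; case/mxvec_indexP: r => t i.
rewrite ketlE !mxE mulr_sumr; apply: eq_bigr => u _.
by rewrite ketlE mulrA.
Qed.

Lemma ketr_mul m n k l (s : 'I_n) (A : 'M[C]_(m, k)) (B : 'M[C]_(k, l)) :
  ketr s (A *m B) = ketr s A *m B.
Proof.
apply/matrixP => r j; case/mxvec_indexP: r => i t.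
rewrite ketrE !mxE mulr_sumr; apply: eq_bigr => u _.
by rewrite ketrE mulrA.
Qed.

Lemma sqfrob_ketl m n k (s : 'I_m) (A : 'M[C]_(n, k)) :
  sqfrob (ketl s A) = sqfrob A.
Proof.
rewrite /sqfrob sum_mxvec_index (bigD1 s) //= addrC big1 ?add0r => [|t /negPf ts].
  by apply: eq_bigr => i _; apply: eq_bigr => j _; rewrite ketlE eqxx mul1r.
by do 2![apply: big1 => ? _]; rewrite ketlE ts mul0r normr0 expr0n.
Qed.

Lemma sqfrob_ketr m n k (s : 'I_n) (A : 'M[C]_(m, k)) :
  sqfrob (ketr s A) = sqfrob A.
Proof.
rewrite /sqfrob sum_mxvec_index [LHS]exchange_big (bigD1 s) //= addrC.
rewrite big1 ?add0r => [|t /negPf ts].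
  by apply: eq_bigr => i _; apply: eq_bigr => j _; rewrite ketrE eqxx mul1r.
by do 2![apply: big1 => ? _]; rewrite ketrE ts mul0r normr0 expr0n.
Qed.

Lemma contraction_ketl m n k (s : 'I_m) (A : 'M[C]_(n, k)) :
  contraction A -> contraction (ketl s A).
Proof. by move=> hA l phi; rewrite -ketl_mul sqfrob_ketl. Qed.

Lemma contraction_ketr m n k (s : 'I_n) (A : 'M[C]_(m, k)) :
  contraction A -> contraction (ketr s A).
Proof. by move=> hA l phi; rewrite -ketr_mul sqfrob_ketr. Qed.

Lemma mulmx_ketl_trmx m n k l (s : 'I_m) (A : 'M[C]_(l, k)) (B : 'M[C]_(n, k))
    i t j :
  (A *m (ketl s B)^T) i (mxvec_index t j) = (t == s)%:R * (A *m B^T) i j.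
Proof.
rewrite !mxE mulr_sumr; apply: eq_bigr => u _.
by rewrite [(ketl s B)^T _ _]mxE ketlE [B^T _ _]mxE mulrCA.
Qed.

Lemma mulmx_bral_trmx m n k l (s : 'I_m) (A : 'M[C]_(l, k))
    (B : 'M[C]_(m * n, k)) i j :
  (A *m (bral s B)^T) i j = (A *m B^T) i (mxvec_index s j).
Proof. by rewrite !mxE; apply: eq_bigr => u _; rewrite !mxE. Qed.

Lemma contraction1 n : contraction (1%:M : 'M[C]_n).
Proof. by move=> k phi; rewrite mul1mx. Qed.

End Contractions.

(** * Acceptance probabilities as inner products *)

Section ProtocolState.
Variables (R : realType) (X Y : Type).
Local Notation C := R[i].

Lemma sqnormE m n (A : 'M[C]_(m, n)) : ((sqnorm A)%:C)%C = sqfrob A.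
Proof.
rewrite /sqnorm rmorph_sum; apply: eq_bigr => i _.
rewrite rmorph_sum; apply: eq_bigr => j _; rewrite rmorphXn.
by rewrite normc_def; case: (A i j).
Qed.

Lemma sqnorm_ge0 m n (A : 'M[C]_(m, n)) : 0 <= sqnorm A.
Proof. by rewrite -ler0c sqnormE sqfrob_ge0. Qed.

Lemma sqnorm_le m n m' n' (A : 'M[C]_(m, n)) (B : 'M[C]_(m', n')) :
  sqfrob A <= sqfrob B -> sqnorm A <= sqnorm B.
Proof. by rewrite -lecR !sqnormE. Qed.

Lemma sqfrob_hand_to_bob a q b (A : 'M[C]_(a * q, b)) :
  sqfrob (hand_to_bob A) = sqfrob A.
Proof.
rewrite /sqfrob sum_mxvec_index; apply: eq_bigr => i _.
rewrite sum_mxvec_index; do 2![apply: eq_bigr => ? _].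
by rewrite hand_to_bobE.
Qed.

Lemma sqfrob_hand_to_alice a q b (A : 'M[C]_(a, q * b)) :
  sqfrob (hand_to_alice A) = sqfrob A.
Proof.
rewrite /sqfrob sum_mxvec_index; apply: eq_bigr => i _.
rewrite sum_mxvec_index; do 2![apply: eq_bigr => ? _].
by rewrite hand_to_aliceE.
Qed.

Lemma sqfrob_isometryr m n k (W : 'M[C]_(n, k)) (A : 'M[C]_(m, k)) :
  isometry W -> sqfrob (A *m W^T) <= sqfrob A.
Proof.
move=> hW; rewrite -sqfrob_trmx trmx_mul trmxK -[leRHS]sqfrob_trmx.
exact: (isometry_contraction hW).
Qed.

(** Handing over a register only reindexes amplitudes, an isometry does not increase the squared
    norm, and the final projection discards amplitudes. *)
Lemma prob_one_bounds a b (P : interaction R X Y a b) x y psi :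
  0 <= prob_one P x y psi <= sqnorm psi.
Proof.
elim: P psi => {a b} [a b k a' V hV P IH|a b k b' W hW P IH|
  a b a' V hV|a b b' W hW] psi /=.
- have /andP[-> h] := IH (hand_to_bob (V x *m psi)); apply: le_trans h _.
  by apply: sqnorm_le; rewrite sqfrob_hand_to_bob; exact: (isometry_contraction (hV x)).
- have /andP[-> h] := IH (hand_to_alice (psi *m (W y)^T)); apply: le_trans h _.
  by apply: sqnorm_le; rewrite sqfrob_hand_to_alice; exact: (sqfrob_isometryr _ (hW y)).
- rewrite sqnorm_ge0; apply: sqnorm_le; apply: le_trans (sqfrob_brar _ _) _.
  exact: (isometry_contraction (hV x)).
- rewrite sqnorm_ge0; apply: sqnorm_le.
  apply: le_trans (_ : sqfrob (psi *m (W y)^T) <= _);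
    last exact: (sqfrob_isometryr _ (hW y)).
  rewrite -sqfrob_trmx -[leRHS]sqfrob_trmx.
  have -> : (\matrix_(i, j) (psi *m (W y)^T) i (mxvec_index ord_max j))^T =
      bral ord_max ((psi *m (W y)^T)^T).
    by apply/matrixP => i j; rewrite [LHS]mxE [LHS]mxE [RHS]mxE [RHS]mxE.
  exact: sqfrob_bral.
Qed.

Lemma accept_prob_bounds (P : protocol R X Y) x y :
  0 <= accept_prob P x y <= 1.
Proof. by rewrite -(initial_state_unit P) prob_one_bounds. Qed.

Variables (dA dB : nat) (psi0 : 'M[C]_(dA, dB)).

(* Each qubit sent doubles the number of terms: the sender's operator projects
   the message onto a basis state, the receiver's operator recreates it. *)
Lemma interaction_decomposition a b (P : interaction R X Y a b) (J : finType)
    (A : J -> X -> 'M[C]_(a, dA)) (B : J -> Y -> 'M[C]_(b, dB)) :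
    (forall j x, contraction (A j x)) -> (forall j y, contraction (B j y)) ->
  exists (J' : finType) (a' b' : nat)
    (A' : J' -> X -> 'M[C]_(a', dA)) (B' : J' -> Y -> 'M[C]_(b', dB)),
    [/\ forall j x, contraction (A' j x), forall j y, contraction (B' j y),
        #|J'| = (#|J| * 2 ^ qubits_sent P)%N
      & forall x y, prob_one P x y (\sum_j A j x *m psi0 *m (B j y)^T) =
          sqnorm (\sum_j A' j x *m psi0 *m (B' j y)^T)].
Proof.
elim: P J A B => {a b} [a b k a' V hV P IH|a b k b' W hW P IH|
  a b a' V hV|a b b' W hW] J A B hA hB /=.
- pose A' (u : J * 'I_(2 ^ k)) x := brar u.2 (V x *m A u.1 x).
  pose B' (u : J * 'I_(2 ^ k)) y := ketl u.2 (B u.1 y).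
  have [||J' [a1 [b1 [A1 [B1 [h1 h2 h3 h4]]]]]] := IH _ A' B'.
  + move=> u x; apply/contraction_brar/contraction_mul => //.
    exact: (isometry_contraction (hV x)).
  + by move=> u y; apply: contraction_ketl.
  exists J', a1, b1, A1, B1; split=> //.
    by rewrite h3 card_prod card_ord expnD mulnA.
  move=> x y; rewrite -h4; congr prob_one.
  apply/matrixP => i r; case/mxvec_indexP: r => t j.
  rewrite hand_to_bobE mulmx_sumr !summxE.
  rewrite -(pair_bigA _ (fun u s => (A' (u, s) x *m psi0 *m (B' (u, s) y)^T)
    i (mxvec_index t j))) /=; apply: eq_bigr => u _.
  rewrite (bigD1 t) //= [X in _ + X]big1 ?addr0 => [|s /negPf ts].
    by rewrite mulmx_ketl_trmx eqxx mul1r -!brar_mul [RHS]mxE !mulmxA.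
  by rewrite mulmx_ketl_trmx eq_sym ts mul0r.
- pose A' (u : J * 'I_(2 ^ k)) x := ketr u.2 (A u.1 x).
  pose B' (u : J * 'I_(2 ^ k)) y := bral u.2 (W y *m B u.1 y).
  have [||J' [a1 [b1 [A1 [B1 [h1 h2 h3 h4]]]]]] := IH _ A' B'.
  + by move=> u x; apply: contraction_ketr.
  + move=> u y; apply/contraction_bral/contraction_mul => //.
    exact: (isometry_contraction (hW y)).
  exists J', a1, b1, A1, B1; split=> //.
    by rewrite h3 card_prod card_ord expnD mulnA.
  move=> x y; rewrite -h4; congr prob_one.
  apply/matrixP => r j; case/mxvec_indexP: r => i t.
  rewrite hand_to_aliceE mulmx_suml !summxE.
  rewrite -(pair_bigA _ (fun u s => (A' (u, s) x *m psi0 *m (B' (u, s) y)^T)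
    (mxvec_index i t) j)) /=; apply: eq_bigr => u _.
  rewrite (bigD1 t) //= [X in _ + X]big1 ?addr0 => [|s /negPf ts].
    rewrite -2!ketr_mul ketrE eqxx mul1r mulmx_bral_trmx.
    by rewrite trmx_mul !mulmxA.
  by rewrite -2!ketr_mul ketrE eq_sym ts mul0r.
- exists J, a', b, (fun j x => brar ord_max (V x *m A j x)), B; split=> //.
  + move=> u x; apply/contraction_brar/contraction_mul => //.
    exact: (isometry_contraction (hV x)).
  + by rewrite muln1.
  move=> x y; congr sqnorm; rewrite mulmx_sumr.
  apply/matrixP => i j; rewrite mxE !summxE; apply: eq_bigr => u _.
  by rewrite -!brar_mul [RHS]mxE !mulmxA.
- exists J, a, b', A, (fun j y => bral ord_max (W y *m B j y)); split=> //.
  + move=> u y; apply/contraction_bral/contraction_mul => //.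
    exact: (isometry_contraction (hW y)).
  + by rewrite muln1.
  move=> x y; congr sqnorm; rewrite mulmx_suml.
  apply/matrixP => i j; rewrite mxE !summxE; apply: eq_bigr => u _.
  by rewrite mulmx_bral_trmx trmx_mul !mulmxA.
Qed.

End ProtocolState.

Section Gram.
Variables (R : realType) (X Y : Type).
Local Notation C := R[i].

(** A certificate that the factorisation norm gamma_2 of the matrix [a] is at most [c]; the lengths
    are squared and the pairing is bilinear. *)
Definition gram_bounded (a : X -> Y -> R) (c : nat) : Prop :=
  exists (K : finType) (u : X -> K -> C) (v : Y -> K -> C),
    [/\ forall x, \sum_k `|u x k| ^+ 2 <= c%:R,
        forall y, \sum_k `|v y k| ^+ 2 <= c%:R
      & forall x y, ((a x y)%:C)%C = \sum_k u x k * v y k].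

(** The squared norm of the sum of [A_j psi B_j^T] expands over pairs [(t, s)]. By cyclicity of the
    trace each term pairs a matrix of Alice, [U], with a matrix of Bob, [V], both of squared length
    at most 1, and there are [4 ^ cost P] pairs. *)
Lemma accept_prob_gram_bounded (P : protocol R X Y) :
  gram_bounded (accept_prob P) (4 ^ cost P).
Proof.
case: P => dA dB psi psi1 P; rewrite /accept_prob /cost /=.
have psiC : sqfrob psi = 1 by rewrite -sqnormE psi1.
have [||J [a [b [A [B [hA hB cJ hP]]]]]] :=
  @interaction_decomposition R X Y dA dB psi dA dB P unit
    (fun _ _ => 1%:M) (fun _ _ => 1%:M).
- by move=> _ _; apply: contraction1.
- by move=> _ _; apply: contraction1.
rewrite card_unit mul1n in cJ.
pose U x (t s : J) := (A s x)^t* *m A t x *m psi.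
pose V y (t s : J) := map_mx Num.conj ((B t y)^t* *m B s y *m psi^T).
exists (J * J * ('I_dA * 'I_dB))%type,
  (fun x k => U x k.1.1 k.1.2 k.2.1 k.2.2),
  (fun y k => V y k.1.1 k.1.2 k.2.2 k.2.1).
have c4 : (4 ^ qubits_sent P = #|{: J * J}|)%N.
  by rewrite card_prod cJ -expnMn.
split=> [x|y|x y].
- rewrite -(pair_bigA _ (fun k l => `|U x k.1 k.2 l.1 l.2| ^+ 2)) /=.
  rewrite c4 -sum1_card natr_sum; apply: ler_sum => -[t s] _ /=.
  rewrite -(pair_bigA _ (fun i j => `|U x t s i j| ^+ 2)) /= -psiC.
  exact: (contraction_mul (contraction_adj (hA s x)) (hA t x)).
- rewrite -(pair_bigA _ (fun k l => `|V y k.1 k.2 l.2 l.1| ^+ 2)) /=.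
  rewrite c4 -sum1_card natr_sum; apply: ler_sum => -[t s] _ /=.
  rewrite -(pair_bigA _ (fun i j => `|V y t s j i| ^+ 2)) /= exchange_big /=.
  have := @contraction_mul _ _ _ _ _ _ (contraction_adj (hB t y)) (hB s y) _ psi^T.
  by rewrite sqfrob_trmx psiC -sqfrob_conj.
have -> : prob_one P x y psi = sqnorm (\sum_j A j x *m psi *m (B j y)^T).
  by rewrite -hP (big_pred1 tt) => [|[]//]; rewrite mul1mx trmx1 mulmx1.
rewrite sqnormE sqfrob_tr.
rewrite -(pair_bigA _ (fun k l => U x k.1 k.2 l.1 l.2 * V y k.1 k.2 l.2 l.1)) /=.
rewrite -(pair_bigA _ (fun t s =>
  \sum_j U x t s j.1 j.2 * V y t s j.2 j.1)) /=.
rewrite mulmx_sumr raddf_sum; apply: eq_bigr => t _ /=.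
rewrite [X in X *m _](_ : _ = \sum_s (A s x *m psi *m (B s y)^T)^t*); last first.
  rewrite raddf_sum /=; apply/matrixP => i j; rewrite !mxE !summxE rmorph_sum.
  by apply: eq_bigr => s _; rewrite [RHS]mxE.
rewrite mulmx_suml raddf_sum; apply: eq_bigr => s _ /=.
rewrite -(pair_bigA _ (fun i j => U x t s i j * V y t s j i)) /=.
transitivity (\tr (U x t s *m V y t s)); last first.
  by apply: eq_bigr => i _; rewrite mxE.
have conjK m n (M : 'M[C]_(m, n)) : map_mx Num.conj (map_mx Num.conj M) = M.
  by apply/matrixP => i j; rewrite !mxE conjCK.
rewrite /U /V !trmx_mul !map_mxM /= conjK trmxK !mulmxA.
by do 4!rewrite [LHS]mxtrace_mulC !mulmxA.
Qed.

End Gram.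

(** * Fourier analysis on matrices *)

Section Fourier.
Variables (R : realType) (F : finFieldType) (chi : F -> R[i]).
Local Notation C := R[i].
Hypothesis chiD : {morph chi : a b / a + b >-> a * b}.
Hypothesis norm_chi : forall a, `|chi a| = 1.
Hypothesis sum_chi : \sum_a chi a = 0.

Lemma chi0 : chi 0 = 1.
Proof.
have chi00 : chi 0 != 0 by rewrite -normr_gt0 norm_chi ltr01.
by apply: (mulfI chi00); rewrite -chiD addr0 mulr1.
Qed.

Lemma conj_chi a : (chi a)^* = chi (- a).
Proof.
have chia0 : chi a != 0 by rewrite -normr_gt0 norm_chi ltr01.
by apply: (mulfI chia0); rewrite -chiD subrr chi0 -normCK norm_chi expr1n.
Qed.

Lemma sum_chi_scale a : \sum_b chi (b * a) = (a == 0)%:R * #|F|%:R.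
Proof.
have [->|a0] := eqVneq a 0.
  by under eq_bigr do rewrite mulr0 chi0; rewrite sumr_const mul1r.
rewrite mul0r (reindex (fun b => b / a)) /=.
  by under eq_bigr do rewrite divfK //.
by exists (fun b => b * a) => b _; rewrite ?mulfK ?divfK.
Qed.

(** Orthogonality of characters: for [U != 0], translating by a [V0] with [chi (\tr (U *m V0)) != 1]
    multiplies the sum by that value, so it vanishes. *)
Lemma sum_chi_tr m n (U : 'M[F]_(m, n)) :
  \sum_V chi (\tr (U *m V)) = (U == 0)%:R * (#|F| ^ (n * m))%:R.
Proof.
have [->|U0] := eqVneq U 0.
  under eq_bigr do rewrite mul0mx mxtrace0 chi0.
  by rewrite sumr_const mul1r card_mx.
have [i [j Uij]] := matrix0Pn _ U0.
have [a chia] : exists a, chi a != 1.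
  apply/existsP; apply: contraT; rewrite negb_exists => /forallP h.
  have: \sum_a chi a = \sum_(a : F) 1.
    by apply: eq_bigr => a _; apply/eqP; have := h a; rewrite negbK.
  rewrite sum_chi sumr_const => /esym/eqP; rewrite pnatr_eq0 => /eqP h0.
  by have := card_finNzRing_gt1 F; rewrite h0.
rewrite mul0r; set S := \sum_V _.
pose V0 := (a / U i j) *: delta_mx j i : 'M[F]_(n, m).
have trV0 : \tr (U *m V0) = a.
  rewrite -scalemxAr mxtraceZ /mxtrace (bigD1 i) //= big1 ?addr0.
    rewrite mxE (bigD1 j) //= big1 ?addr0 => [|k /negPf kj].
      by rewrite mxE !eqxx mulr1 divfK.
    by rewrite mxE kj mulr0.
  move=> k /negPf ki; rewrite mxE big1 // => l _.
  by rewrite mxE ki andbF mulr0.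
have : S = chi a * S.
  rewrite {1}/S (reindex (fun V => V0 + V)) /=.
    rewrite mulr_sumr; apply: eq_bigr => V _.
    by rewrite mulmxDr raddfD /= chiD trV0.
  by exists (fun V => V - V0) => V _; [rewrite addrC addKr | rewrite addrC subrK].
move/eqP; rewrite -[X in X == _]mul1r -subr_eq0 -mulrBl mulf_eq0 subr_eq0.
by rewrite eq_sym (negPf chia) => /eqP.
Qed.

Lemma parseval n (f : 'M[F]_n -> C) :
  \sum_M `|\sum_Z chi (\tr (M *m Z)) * f Z| ^+ 2 =
    (#|F| ^ (n * n))%:R * \sum_Z `|f Z| ^+ 2.
Proof.
transitivity (\sum_M \sum_Z \sum_W
    (f Z * (f W)^*) * chi (\tr ((Z - W) *m M))).
  apply: eq_bigr => M _; rewrite normCK rmorph_sum mulr_suml.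
  apply: eq_bigr => Z _; rewrite mulr_sumr; apply: eq_bigr => W _.
  rewrite rmorphM /= conj_chi mulmxBl raddfB /= chiD.
  by rewrite ![\tr (M *m _)]mxtrace_mulC; ring.
rewrite exchange_big mulr_sumr; apply: eq_bigr => Z _.
rewrite exchange_big (bigD1 Z) //= [X in _ + X]big1 ?addr0 => [|W /negPf WZ].
  rewrite -mulr_sumr sum_chi_tr subrr eqxx mul1r mulrC.
  by rewrite normCK.
by rewrite -mulr_sumr sum_chi_tr subr_eq0 eq_sym WZ mul0r mulr0.
Qed.

Definition flat_spectrum n (G : 'M[F]_n -> R) : Prop :=
  exists w : 'M[F]_n -> C, (forall M, `|w M| <= 1) /\
    forall Z, ((G Z)%:C)%C = \sum_M w M * chi (\tr (M *m Z)).

(** The character of [x + y] splits into a product, so the sum becomes that of [w * fu * fv], with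
    [fu] and [fv] the transforms of Alice's and Bob's vectors. Parseval bounds the squared length of
    each by [N^2 * c]. *)
Lemma flat_spectrum_gram n (G : 'M[F]_n -> R) (a : 'M[F]_n -> 'M[F]_n -> R) c :
  flat_spectrum G -> gram_bounded a c ->
  `|\sum_x \sum_y G (x + y) * a x y| <= (#|F| ^ (n * n))%:R ^+ 2 * c%:R.
Proof.
move=> [w [w1 hG]] [K [u [v [hu hv ha]]]].
set N := (#|F| ^ (n * n))%N.
pose fu M k := \sum_Z chi (\tr (M *m Z)) * u Z k.
pose fv M k := \sum_Z chi (\tr (M *m Z)) * v Z k.
have fourier_bound (g : 'M[F]_n -> K -> C) :
    (forall x, \sum_k `|g x k| ^+ 2 <= c%:R) ->
    \sum_M \sum_k `|\sum_Z chi (\tr (M *m Z)) * g Z k| ^+ 2 <= N%:R ^+ 2 * c%:R.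
  move=> hg; rewrite exchange_big /=; under eq_bigr do rewrite parseval -/N.
  rewrite -mulr_sumr exchange_big expr2 -mulrA ler_wpM2l //.
  apply: le_trans (_ : \sum_(Z : 'M[F]_n) c%:R <= _); first exact: ler_sum.
  by rewrite sumr_const card_mx -/N mulr_natl.
rewrite -lecR.
have <- x : `|((x%:C)%C : C)| = ((`|x|)%:C)%C.
  by rewrite normc_def /= expr0n addr0 sqrtr_sqr.
have -> : ((\sum_x \sum_y G (x + y) * a x y)%:C)%C =
    \sum_M \sum_k w M * (fu M k * fv M k).
  transitivity (\sum_x \sum_y \sum_M \sum_k
     w M * ((chi (\tr (M *m x)) * u x k) * (chi (\tr (M *m y)) * v y k))).
    rewrite rmorph_sum; apply: eq_bigr => x _.
    rewrite rmorph_sum; apply: eq_bigr => y _.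
    rewrite rmorphM /= hG ha mulr_suml; apply: eq_bigr => M _.
    rewrite mulr_sumr; apply: eq_bigr => k _.
    by rewrite mulmxDr raddfD /= chiD; ring.
  under eq_bigr do rewrite exchange_big /=.
  rewrite exchange_big; apply: eq_bigr => M _.
  under eq_bigr do rewrite exchange_big /=.
  rewrite exchange_big; apply: eq_bigr => k _.
  rewrite /fu /fv mulr_suml mulr_sumr; apply: eq_bigr => x _.
  by rewrite !mulr_sumr; apply: eq_bigr => y _.
(* Both sides are doubled so that [2 |fu fv| <= |fu|^2 + |fv|^2] can replace Cauchy-Schwarz. *)
rewrite rmorphM rmorphXn !rmorph_nat -(ler_pM2l (ltr0Sn _ 1)).
apply: le_trans (_ : \sum_M \sum_k (`|fu M k| ^+ 2 + `|fv M k| ^+ 2) <= _).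
  apply: le_trans (ler_wpM2l _ (ler_norm_sum _ _ _)) _ => //.
  rewrite mulr_sumr; apply: ler_sum => M _.
  apply: le_trans (ler_wpM2l _ (ler_norm_sum _ _ _)) _ => //.
  rewrite mulr_sumr; apply: ler_sum => k _.
  rewrite !normrM.
  apply: le_trans (_ : 2 * (`|fu M k| * `|fv M k|) <= _).
    by rewrite ler_wpM2l // ler_piMl // mulr_ge0.
  rewrite -subr_ge0.
  have -> : `|fu M k| ^+ 2 + `|fv M k| ^+ 2 - 2 * (`|fu M k| * `|fv M k|) =
    (`|fu M k| - `|fv M k|) ^+ 2 by ring.
  by rewrite real_exprn_even_ge0 // realB // normr_real.
under eq_bigr do rewrite big_split /=.
by rewrite big_split /= mulrDl mul1r lerD // fourier_bound.
Qed.

End Fourier.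

(** * The bordering construction *)

Lemma sum_block_mx (R : nmodType) (F : finType) m1 m2 n1 n2
    (f : 'M[F]_(m1 + m2, n1 + n2) -> R) :
  \sum_T f T = \sum_e \sum_d \sum_c \sum_Z f (block_mx e d c Z).
Proof.
rewrite (pair_bigA _ (fun e d => \sum_c \sum_Z f (block_mx e d c Z))) /=.
rewrite (pair_bigA _ (fun u c => \sum_Z f (block_mx u.1 u.2 c Z))) /=.
rewrite (pair_bigA _ (fun u Z => f (block_mx u.1.1 u.1.2 u.2 Z))) /=.
rewrite (reindex (fun u => block_mx u.1.1.1 u.1.1.2 u.1.2 u.2)) //=.
exists (fun T => (ulsubmx T, ursubmx T, dlsubmx T, drsubmx T)) => [[[[e d] c] Z]|T] _ /=.
  by rewrite block_mxKul block_mxKur block_mxKdl block_mxKdr.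
by rewrite submxK.
Qed.

Section Border.
Variables (R : realType) (F : finFieldType).
Local Notation C := R[i].
Local Notation q := (#|F|).

(** The sum of [chi (b * a)] over [b != 0], as a function of [a == 0]; its mean over the field is
    zero. *)
Definition gap (b : bool) : R := q%:R * b%:R - 1.

(** Summing over all solutions of [Z X = c] replaces [Z^-1 c] when [Z] may be singular. The power of
    [q] is the one produced by the Fourier sum over an off-diagonal block. *)
Definition border l k (G : 'M[F]_k -> R) (T : 'M[F]_(l + k)) : R :=
  G (drsubmx T) * (q ^ (k * l))%:R *
  \sum_(X : 'M_(k, l) | drsubmx T *m X == dlsubmx T)
    gap (\tr (ulsubmx T) == \tr (ursubmx T *m X)).

Lemma borderE l k (G : 'M[F]_k -> R) e d c Z :
  border G (block_mx e d c Z : 'M_(l + k)) =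
  G Z * (q ^ (k * l))%:R *
  \sum_(X : 'M_(k, l) | Z *m X == c) gap (\tr e == \tr (d *m X)).
Proof. by rewrite /border block_mxKul block_mxKur block_mxKdl block_mxKdr. Qed.

Section Flat.
Variable chi : F -> C.
Hypothesis chiD : {morph chi : a b / a + b >-> a * b}.
Hypothesis norm_chi : forall a, `|chi a| = 1.
Hypothesis sum_chi : \sum_a chi a = 0.

Lemma sum_chi_neq0 a : \sum_(b | b != 0) chi (b * a) = ((gap (a == 0))%:C)%C.
Proof.
have := sum_chi_scale chiD norm_chi sum_chi a.
rewrite (bigD1 0) //= mul0r (chi0 chiD norm_chi) => /(canRL (addKr _)) ->.
by rewrite /gap rmorphB rmorphM !rmorph_nat rmorph1 addrC mulrC.
Qed.

Lemma flat_spectrum_border l k (G : 'M[F]_k -> R) :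
  flat_spectrum chi G -> flat_spectrum chi (@border l.+1 k G).
Proof.
move=> [w [w1 hG]].
(* Only the blocks [b%:M] with [b != 0] occur in the corner of [N]; the Schur
   complement comes from completing the square. *)
pose w' (N : 'M[F]_(l.+1 + k)) : C := let U := ulsubmx N in
  if (U 0 0 != 0) && (U == (U 0 0)%:M)
  then w (drsubmx N - (U 0 0)^-1 *: (dlsubmx N *m ursubmx N)) else 0.
exists w'; split=> [M|T].
  by rewrite /w' /=; case: ifP => // _; rewrite normr0 ler01.
rewrite -(submxK T); move: (ulsubmx T) (ursubmx T) (dlsubmx T) (drsubmx T) => e d c Z.
rewrite borderE sum_block_mx.
(* In the shifted variable [M] the phases separate: [M] meets only [Z], and [d'] enters linearly. *)
transitivity (\sum_(b | b != 0) \sum_d' \sum_c' \sum_M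
    w M * chi (\tr (M *m Z)) * (chi (b * \tr e + \tr (d *m c')) *
      chi (\tr ((c + b^-1 *: (Z *m c')) *m d')))); last first.
  transitivity (\sum_(U : 'M[F]_l.+1 | (U 0 0 != 0) && (U == (U 0 0)%:M))
      \sum_d' \sum_c' \sum_B w (B - (U 0 0)^-1 *: (c' *m d')) *
        chi (\tr (block_mx U d' c' B *m block_mx e d c Z))).
    rewrite (reindex_onto (fun b => b%:M) (fun U : 'M[F]_l.+1 => U 0 0)) /=;
      last by move=> U /andP[_ /eqP <-].
    apply: eq_big => [b|b b0]; first by rewrite !mxE !eqxx !andbT.
    apply: eq_bigr => d' _; apply: eq_bigr => c' _.
    rewrite mxE eqxx mulr1n.
    rewrite [RHS](reindex (fun M => M + b^-1 *: (c' *m d'))) /=; last first.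
      exists (fun B => B - b^-1 *: (c' *m d')) => B _; first by rewrite addrK.
      by rewrite subrK.
    apply: eq_bigr => M _; rewrite addrK -mulrA; congr (_ * _).
    rewrite mulmx_block mxtrace_block mul_scalar_mx -!chiD; congr chi.
    rewrite !mulmxDl -!scalemxAl !raddfD /= !mxtraceZ.
    rewrite (mxtrace_mulC d' c) (mxtrace_mulC c' d) -(mulmxA c' d').
    by rewrite (mxtrace_mulC c' (d' *m Z)) -(mulmxA d') (mxtrace_mulC d'); ring.
  rewrite big_mkcond /=; apply: eq_bigr => U _; case: ifP => hU.
    do 3![apply: eq_bigr => ? _].
    by rewrite /w' block_mxKul block_mxKur block_mxKdl block_mxKdr hU.
  rewrite big1 // => d' _; rewrite big1 // => c' _; rewrite big1 // => B _.
  by rewrite /w' block_mxKul hU mul0r.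
(* The sum over [M] is [G Z], and the sum over [d'] is the orthogonality relation forcing
   [Z c' = - b c]. *)
transitivity (\sum_(b | b != 0) ((G Z)%:C)%C * \sum_c' chi (b * \tr e + \tr (d *m c')) *
   ((c + b^-1 *: (Z *m c') == 0)%:R * (q ^ (l.+1 * k))%:R)); last first.
  apply: eq_bigr => b b0; rewrite exchange_big mulr_sumr; apply: eq_bigr => c' _ /=.
  rewrite -(sum_chi_tr chiD norm_chi sum_chi) hG mulr_sumr mulr_sumr.
  apply: eq_bigr => d' _; rewrite mulr_suml.
  by apply: eq_bigr => M _.
(* With [c' = - b X] the constraint reads [Z X = c], and the remaining sum over [b] is [gap]. *)
transitivity (\sum_(b | b != 0) ((G Z)%:C)%C * \sum_(X : 'M_(k, l.+1))
   chi (b * (\tr e - \tr (d *m X))) * ((Z *m X == c)%:R * (q ^ (k * l.+1))%:R)); last first.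
  apply: eq_bigr => b b0; congr (_ * _).
  rewrite [RHS](reindex (fun X => (- b) *: X)) /=; last first.
    exists (fun X => (- b)^-1 *: X) => X _; rewrite scalerA.
      by rewrite mulVf ?oppr_eq0 // scale1r.
    by rewrite divff ?oppr_eq0 // scale1r.
  apply: eq_bigr => X _; rewrite mulnC -scalemxAr mxtraceZ -scalemxAr scalerA.
  rewrite mulrN mulVf // scaleN1r subr_eq0 [c == _]eq_sym; congr (chi _ * _).
  by ring.
rewrite -mulr_sumr rmorphM rmorphM /= -mulrA; congr (_ * _).
rewrite exchange_big mulrC rmorph_sum mulr_suml big_mkcond /=.
apply: eq_bigr => X _; rewrite -mulr_suml sum_chi_neq0 subr_eq0 rmorph_nat.
by case: eqP; rewrite ?mul1r // mul0r mulr0.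
Qed.

Fixpoint witness k : 'M[F]_k -> R :=
  match k return 'M[F]_k -> R with
  | 0 => fun=> 1
  | k'.+1 => @border 1 k' (@witness k')
  end.

Lemma flat_spectrum_witness k : flat_spectrum chi (@witness k).
Proof.
elim: k => [|k IH]; last exact: (@flat_spectrum_border 0 k _ IH).
exists (fun=> 1); split=> [M|Z]; first by rewrite normr1.
rewrite (bigD1 0) //= big1 ?addr0 => [|M /eqP[]]; last exact/flatmx0.
by rewrite mul0mx mxtrace0 (chi0 chiD norm_chi) mulr1.
Qed.

End Flat.
End Border.

(** * Mass of the witness *)

(** Block elimination. Writing the off-diagonal blocks as multiples of [Z] makes the Schur
    complement available without inverting [Z]. *)
Lemma mxrank_schur (F : fieldType) m1 m2 n1 n2 (e : 'M[F]_(m1, n1))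
    (Y : 'M_(m1, m2)) (X : 'M_(n2, n1)) (Z : 'M_(m2, n2)) :
  \rank (block_mx e (Y *m Z) (Z *m X) Z) =
    (\rank (e - Y *m Z *m X)%R + \rank Z)%N.
Proof.
have -> : block_mx e (Y *m Z) (Z *m X) Z =
    block_mx 1%:M Y 0 1%:M *m
      (block_mx (e - Y *m Z *m X) 0 0 Z *m block_mx 1%:M 0 X 1%:M).
  rewrite !mulmx_block !(mul0mx, mulmx0, mul1mx, mulmx1, add0r, addr0).
  by rewrite mulmxA subrK.
have Uu : row_full (block_mx 1%:M Y 0 1%:M : 'M[F]_(m1 + m2)).
  by rewrite row_full_unit unitmxE det_ublock !det1 mulr1 unitr1.
have Ul : row_free (block_mx 1%:M 0 X 1%:M : 'M[F]_(n1 + n2)).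
  by rewrite row_free_unit unitmxE det_lblock !det1 mulr1 unitr1.
by rewrite (eqmxMfull _ Uu) mxrankMfree // rank_diag_block_mx.
Qed.

Lemma card_submx (F : finFieldType) l m n (Z : 'M[F]_(m, n)) :
  (#|[pred d : 'M[F]_(l, n) | (d <= Z)%MS]| <= #|F| ^ (l * \rank Z))%N.
Proof.
rewrite -card_mx.
rewrite (leq_trans _ (leq_image_card (fun Y => Y *m row_base Z) _)) //.
apply/subset_leq_card/subsetP => d; rewrite inE -(eq_row_base Z) => /submxP[Y ->].
exact/imageP/ex_intro2.
Qed.

(** Vanishing of the trace of the Schur complement. It has this meaning only for an invertible lower
    right block, since [invmx] returns a singular matrix unchanged. *)
Definition schur_zero (F : fieldType) l k (T : 'M[F]_(l + k)) : bool :=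
  \tr (ulsubmx T) == \tr (ursubmx T *m invmx (drsubmx T) *m dlsubmx T).

Section Mass.
Variables (R : realType) (F : finFieldType).
Local Notation q := (#|F|).
Local Notation qR := (#|F|%:R : R).
Local Notation gap := (@gap R F).
Local Notation witness := (@witness R F).

Lemma card_field_ge2 : 2 <= qR.
Proof. by rewrite ler_nat card_finNzRing_gt1. Qed.

Lemma gap_true : `|gap true| = qR - 1.
Proof. by rewrite /gap mulr1 ger0_norm // subr_ge0 (le_trans _ card_field_ge2) // ler1n. Qed.

Lemma gap_false : `|gap false| = 1.
Proof. by rewrite /gap mulr0 sub0r normrN1. Qed.

Lemma sum_gap (a : F) : \sum_b gap (a == b) = 0.
Proof.
rewrite /gap big_split /= -mulr_sumr (bigD1 a) //= eqxx big1 => [|b].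
  by rewrite addr0 mulr1 sumr_const mulNrn subrr.
by rewrite eq_sym => /negPf ->.
Qed.

(* Shifting [X] by multiples of a [V] with [Z V = 0] and [tr(d V) != 0] makes
   [tr(d X)] equidistributed. *)
Lemma border_eq0 l k (G : 'M[F]_k -> R) e (d : 'M_(l, k)) c Z :
  ~~ (d <= Z)%MS -> border G (block_mx e d c Z : 'M_(l + k)) = 0.
Proof.
rewrite submxE borderE => dZ.
have [i [j dij]] := matrix0Pn _ dZ.
pose V : 'M_(k, l) := cokermx Z *m delta_mx j i.
have ZV : Z *m V = 0 by rewrite mulmxA mulmx_coker mul0mx.
have dV : \tr (d *m V) != 0.
  rewrite mulmxA /mxtrace (bigD1 i) //= big1 ?addr0.
    rewrite mxE (bigD1 j) //= big1 ?addr0 => [|n /negPf nj].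
      by rewrite [delta_mx _ _ _ _]mxE !eqxx mulr1.
    by rewrite [delta_mx _ _ _ _]mxE nj mulr0.
  move=> n /negPf ni; rewrite mxE big1 // => r _.
  by rewrite [delta_mx _ _ _ _]mxE ni andbF mulr0.
set S := \sum_(_ | _) _; suff -> : S = 0 by rewrite mulr0.
apply/eqP; have := pnatr_eq0 R q; rewrite -[q == 0%N]negbK -lt0n.
rewrite (ltnW (card_finNzRing_gt1 F)) /= => q0.
suff /eqP : qR * S = 0 by rewrite mulf_eq0 q0.
have shift a : S = \sum_(X | Z *m X == c) gap (\tr e - \tr (d *m X) == a * \tr (d *m V)).
  rewrite /S (reindex (fun X => X + a *: V)) /=; last first.
    by exists (fun X => X - a *: V) => X _; rewrite ?addrK ?subrK.
  apply: eq_big => [X|X _]; rewrite mulmxDr -scalemxAr ?ZV ?scaler0 ?addr0 //.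
  by rewrite raddfD /= mxtraceZ subr_eq addrC.
rewrite mulr_natl -sumr_const (eq_bigr _ (fun a _ => shift a)) exchange_big big1 // => X _.
rewrite (reindex (fun b => b / \tr (d *m V))) /=; last first.
  by exists (fun a => a * \tr (d *m V)) => b _; rewrite ?divfK ?mulfK.
by under eq_bigr do rewrite divfK //; rewrite sum_gap.
Qed.

(** Triangle inequality over the solutions [X]: summing over [c] leaves [X] free, and a [d] outside
    the row space of [Z] contributes nothing. The weight [omega] will be 1 or a power of [q]
    depending on the rank. *)
Lemma border_mass l k (G : 'M[F]_k -> R) Z (omega : 'M[F]_(l + k) -> R) :
    (forall T, 0 <= omega T) ->
  \sum_e \sum_d \sum_c `|border G (block_mx e d c Z : 'M_(l + k))| *
      omega (block_mx e d c Z) <=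
  `|G Z| * (q ^ (k * l))%:R * \sum_(d | (d <= Z)%MS) \sum_(X : 'M_(k, l)) \sum_e
    `|gap (\tr e == \tr (d *m X))| * omega (block_mx e d (Z *m X) Z).
Proof.
move=> omega0.
apply: le_trans (_ : \sum_e \sum_(d | (d <= Z)%MS)
   \sum_c \sum_(X : 'M_(k, l) | Z *m X == c)
   `|G Z| * (q ^ (k * l))%:R *
     (`|gap (\tr e == \tr (d *m X))| * omega (block_mx e d (Z *m X) Z)) <= _).
  apply: ler_sum => e _; rewrite [leRHS]big_mkcond; apply: ler_sum => d _ /=.
  case: ifP => [_|/negbT dZ]; last first.
    by rewrite big1 // => c _; rewrite border_eq0 // normr0 mul0r.
  apply: ler_sum => c _; rewrite borderE !normrM normr_nat -mulr_sumr.
  rewrite -[leLHS]mulrA ler_wpM2l ?mulr_ge0 //.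
  apply: le_trans (ler_wpM2r (omega0 _) (ler_norm_sum _ _ _)) _.
  by rewrite mulr_suml; apply: ler_sum => X /eqP ->.
rewrite exchange_big mulr_sumr; apply: ler_sum => d _.
rewrite [X in _ <= _ * X]exchange_big mulr_sumr; apply: ler_sum => e _ /=.
rewrite mulr_sumr; under eq_bigr do rewrite big_mkcond.
rewrite exchange_big; apply: ler_sum => X _ /=.
by rewrite -big_mkcond (big_pred1 (Z *m X)) => [|c]; rewrite // eq_sym.
Qed.

Lemma gap_ge1 b : 1 <= `|gap b|.
Proof.
case: b; rewrite ?gap_false // gap_true lerBrDr (le_trans _ card_field_ge2) //.
Qed.

Definition gap_mass l : R := \sum_(e : 'M[F]_l) `|gap (\tr e == 0)|.

Lemma gap_mass_ge l : (q ^ (l * l))%:R <= gap_mass l.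
Proof.
rewrite -card_mx -sum1_card natr_sum; apply: ler_sum => e _.
exact: gap_ge1.
Qed.

Lemma sum_tr_eq l (f : bool -> R) a :
  \sum_(e : 'M[F]_l.+1) f (\tr e == a) = \sum_(e : 'M[F]_l.+1) f (\tr e == 0).
Proof.
pose D : 'M[F]_l.+1 := a *: delta_mx 0 0.
have trD : \tr D = a.
  rewrite mxtraceZ /mxtrace (bigD1 0) //= big1 ?addr0 => [|i /negPf i0].
    by rewrite mxE eqxx mulr1.
  by rewrite mxE i0.
rewrite (reindex (fun e => e + D)) /=; last first.
  by exists (fun e => e - D) => e _; rewrite ?addrK ?subrK.
by apply: eq_bigr => e _; rewrite raddfD /= trD -subr_eq0 addrK.
Qed.

Lemma sum_gap_tr l a :
  \sum_(e : 'M[F]_l.+1) `|gap (\tr e == a)| = gap_mass l.+1.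
Proof. exact: (sum_tr_eq l (fun b => `|gap b|)). Qed.

(** The loss against the invertible case comes from the number of admissible [d]: at most
    [q^(l.+1 * \rank Z)] instead of [q^(l.+1 * k)]. This is the damping by the corank. *)
Lemma border_mass_total l k (G : 'M[F]_k -> R) Z :
  \sum_e \sum_d \sum_c `|border G (block_mx e d c Z : 'M_(l.+1 + k))| <=
  `|G Z| * qR ^+ (k * l.+1) *
    (qR ^+ (l.+1 * \rank Z) * qR ^+ (k * l.+1) * gap_mass l.+1).
Proof.
have := @border_mass l.+1 k G Z (fun=> 1) (fun=> ler01).
under [leLHS]eq_bigr do under eq_bigr do under eq_bigr do rewrite mulr1.
move=> /le_trans; apply; rewrite natrX ler_wpM2l ?mulr_ge0 ?exprn_ge0 //.
under eq_bigr do under eq_bigr do under eq_bigr do rewrite mulr1.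
under eq_bigr do under eq_bigr do rewrite sum_gap_tr.
rewrite !sumr_const card_mx -[_ *+ #|_|]mulr_natr -[_ *+ (_ ^ _)]mulr_natr
   -mulrA mulrC -!natrX -!natrM.
rewrite ler_wpM2r ?(le_trans _ (gap_mass_ge _)) // ler_nat mulnC leq_mul2r.
by apply/orP; right; exact: card_submx.
Qed.

Lemma border_unitmx l k (G : 'M[F]_k -> R) e d c Z : Z \in unitmx ->
  border G (block_mx e d c Z : 'M_(l + k)) =
  G Z * qR ^+ (k * l) * gap (\tr e == \tr (d *m invmx Z *m c)).
Proof.
move=> uZ; rewrite borderE natrX (big_pred1 (invmx Z *m c)) ?mulmxA // => X.
exact: (can2_eq (mulKmx uZ) (mulKVmx uZ)).
Qed.

Lemma border_mass_unitmx l k (G : 'M[F]_k -> R) Z : Z \in unitmx ->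
  \sum_e \sum_d \sum_c `|border G (block_mx e d c Z : 'M_(l.+1 + k))| =
  `|G Z| * qR ^+ (k * l.+1) *
    (qR ^+ (k * l.+1) * qR ^+ (k * l.+1) * gap_mass l.+1).
Proof.
move=> uZ.
under eq_bigr do under eq_bigr do under eq_bigr do
  rewrite border_unitmx // !normrM [`|qR ^+ _|]ger0_norm ?exprn_ge0 //.
rewrite exchange_big /=; under eq_bigr do rewrite exchange_big /=.
under eq_bigr do under eq_bigr do rewrite -mulr_sumr sum_gap_tr.
rewrite !sumr_const !card_mx -mulrnA -[LHS]mulr_natr natrM !natrX.
by rewrite [(l.+1 * k)%N]mulnC; ring.
Qed.

(** For [s = l.+1] the weight is, up to factors independent of [Z], the bound of [border_mass_total]
    on what a last border leaves above [Z]. *)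
Definition rank_mass s k : R := \sum_Z `|witness Z| * qR ^+ (s * @mxrank F k k Z).

Definition unit_mass k : R := \sum_(Z : 'M[F]_k | Z \in unitmx) `|witness Z|.

Definition base_mass k : R := \prod_(i < k) (qR ^+ (3 * i) * (qR - 1)).

Lemma base_mass_rec k : base_mass k.+1 = base_mass k * (qR ^+ (3 * k) * (qR - 1)).
Proof. by rewrite /base_mass big_ord_recr. Qed.

(** One corner [e] makes the Schur complement zero, with [|gap| = q - 1] and the rank of [Z]; the
    other [q - 1] have [|gap| = 1] and rank one more. The at most [q^(\rank Z)] choices of [d] raise
    [s] to [s.+1]. *)
Lemma rank_mass_rec s k :
  rank_mass s k.+1 <= qR ^+ (2 * k) * (qR - 1) * (1 + qR ^+ s) * rank_mass s.+1 k.
Proof.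
rewrite /rank_mass (@sum_block_mx _ _ 1 k 1 k) /=.
under eq_bigr do under eq_bigr do rewrite exchange_big /=.
under eq_bigr do rewrite exchange_big /=.
rewrite exchange_big mulr_sumr; apply: ler_sum => Z _ /=.
pose omega (T : 'M[F]_(1 + k)) := qR ^+ (s * \rank T).
have omega0 T : 0 <= omega T by rewrite exprn_ge0.
apply: le_trans (@border_mass 1 k (@witness k) Z omega omega0) _.
apply: le_trans (_ : `|witness Z| * qR ^+ k * (\sum_(d : 'rV[F]_k | (d <= Z)%MS)
  \sum_(X : 'cV[F]_k) ((qR - 1) * (1 + qR ^+ s) * qR ^+ (s * \rank Z))) <= _).
  rewrite muln1 natrX ler_wpM2l ?mulr_ge0 ?exprn_ge0 //.
  apply: ler_sum => d /submxP[Y ->]; apply: ler_sum => X _.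
  rewrite (bigD1 (Y *m Z *m X)) //= eqxx gap_true /omega mxrank_schur subrr mxrank0 add0n.
  set t0 := (X in X + _ <= _).
  apply: le_trans (_ : t0 + \sum_(e : 'M[F]_1 | e != Y *m Z *m X)
    qR ^+ (s * (1 + \rank Z)) <= _).
    rewrite lerD2l; apply: ler_sum => e ne.
    have -> : (\tr e == \tr (Y *m Z *m X)) = false.
      by apply/negbTE; apply: contra ne => /eqP h; rewrite [e]mx11_scalar
        [Y *m Z *m X]mx11_scalar -!trace_mx11 h.
    rewrite gap_false mul1r mxrank_schur rank_rV subr_eq0 ne //.
  rewrite sumr_const.
  have -> : #|(fun e : 'M[F]_1 => e != Y *m Z *m X)| = q.-1.
    by have := cardC1 (Y *m Z *m X); rewrite card_mx expn1 => <-.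
  rewrite -[_ *+ q.-1]mulr_natr -subn1 natrB ?(ltnW (card_finNzRing_gt1 F)) //.
  by rewrite mulnDr muln1 exprD /t0 le_eqVlt; apply/orP; left; apply/eqP; ring.
rewrite !sumr_const card_mx -[_ *+ #|_|]mulr_natr -[_ *+ (_ ^ _)]mulr_natr.
set u := #|_|.
have hu : (u%:R : R) <= qR ^+ \rank Z.
  by rewrite -natrX ler_nat -[\rank Z]mul1n card_submx.
have q1 : 0 <= qR - 1 by rewrite subr_ge0 (le_trans _ card_field_ge2) // ler1n.
rewrite -mulrA; apply: le_trans (ler_wpM2l _ (ler_wpM2l _ (ler_wpM2l _ hu))) _ => //.
- by rewrite exprn_ge0.
- by rewrite !mulr_ge0 ?exprn_ge0 // addr_ge0 ?exprn_ge0.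
rewrite muln1 natrX !mulSn mul0n addn0 !exprD le_eqVlt; apply/orP; left.
by apply/eqP; ring.
Qed.

(** Keep only invertible [Z] and corners [e] off the value [d Z^-1 c]: there are [q^(2k)] pairs
    [(d, c)] and [q - 1] corners, [|gap|] is 1 and the normalisation is [q^k]. *)
Lemma unit_mass_rec k :
  unit_mass k * (qR ^+ (3 * k) * (qR - 1)) <= unit_mass k.+1.
Proof.
rewrite /unit_mass [leRHS]big_mkcond (@sum_block_mx _ _ 1 k 1 k) /=.
under [leRHS]eq_bigr do under eq_bigr do rewrite exchange_big /=.
under [leRHS]eq_bigr do rewrite exchange_big /=.
rewrite [leRHS]exchange_big mulr_suml [leLHS]big_mkcond; apply: ler_sum => Z _ /=.
case: ifP => uZ; last first.
  by do 3!apply: sumr_ge0 => ? _; case: ifP => //.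
rewrite [leRHS]exchange_big /=; under [leRHS]eq_bigr do rewrite exchange_big /=.
apply: le_trans (_ : \sum_(d : 'rV[F]_k) \sum_(c : 'cV[F]_k)
  `|witness Z| * qR ^+ k * (qR - 1) <= _).
  rewrite !sumr_const !card_mx muln1 mul1n -mulrnA -[_ *+ (_ * _)]mulr_natr natrM natrX.
  by rewrite !mulSn mul0n addn0 !exprD le_eqVlt; apply/orP; left; apply/eqP; ring.
apply: ler_sum => d _; apply: ler_sum => c _.
apply: le_trans (_ : \sum_(e : 'M[F]_1 | e != d *m invmx Z *m c)
  `|witness Z| * qR ^+ k <= _).
  rewrite sumr_const.
  have -> : #|(fun e : 'M[F]_1 => e != d *m invmx Z *m c)| = q.-1.
    by have := cardC1 (d *m invmx Z *m c); rewrite card_mx expn1 => <-.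
  by rewrite -[_ *+ q.-1]mulr_natr -subn1 natrB ?(ltnW (card_finNzRing_gt1 F)).
rewrite big_mkcond; apply: ler_sum => e _; case: ifP => [ne|_]; last by case: ifP.
have -> : block_mx e d c Z \in unitmx.
  rewrite -row_free_unit -row_leq_rank -{1}(mulmxKV uZ d) -{1}(mulKVmx uZ c).
  rewrite mxrank_schur rank_rV subr_eq0 mulmxKV // mulmxA ne leq_add2l.
  by rewrite row_leq_rank row_free_unit.
rewrite border_unitmx // muln1.
have -> : (\tr e == \tr (d *m invmx Z *m c)) = false.
  by apply/negbTE; apply: contra ne => /eqP h; rewrite [e]mx11_scalar
    [d *m invmx Z *m c]mx11_scalar -!trace_mx11 h.
by rewrite !normrM gap_false mulr1 [`|qR ^+ k|]ger0_norm ?exprn_ge0.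
Qed.

Lemma unit_mass_ge k : base_mass k <= unit_mass k.
Proof.
elim: k => [|k IH].
  rewrite /base_mass big_ord0 /unit_mass (big_pred1 0) /= ?normr1 // => Z.
  by rewrite unitmxE det_mx00 unitr1; apply/esym/eqP; rewrite [Z]flatmx0.
rewrite base_mass_rec; apply: le_trans (unit_mass_rec k); rewrite ler_wpM2r //.
by rewrite mulr_ge0 ?exprn_ge0 // subr_ge0 (le_trans _ card_field_ge2) // ler1n.
Qed.

(** The recursion raises [s] as it lowers [k], hence the induction over all [s]; the successive
    losses [1 + q^-s] are absorbed by [1 + 4 / 2^s]. *)
Lemma rank_mass_le s k : (0 < s)%N ->
  rank_mass s k <= (1 + 4 / 2 ^+ s) * qR ^+ (s * k) * base_mass k.
Proof.
have q0 : 0 < qR by apply: lt_le_trans card_field_ge2; rewrite ltr0n.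
have q1 : 0 <= qR - 1 by rewrite subr_ge0 (le_trans _ card_field_ge2) // ler1n.
elim: k s => [|k IH] s s0.
  rewrite /rank_mass (big_pred1 0) => [|Z]; last by apply/esym/eqP; rewrite [Z]flatmx0.
  rewrite mxrank0 !muln0 !expr0 /base_mass big_ord0 /= normr1 !mulr1.
  by rewrite lerDl divr_ge0 // exprn_ge0.
apply: le_trans (rank_mass_rec s k) _.
apply: le_trans (ler_wpM2l _ (IH s.+1 isT)) _.
  by rewrite !mulr_ge0 ?exprn_ge0 ?q1 // addr_ge0 ?exprn_ge0.
rewrite base_mass_rec.
(* With [x = 2^-s] this reduces to [1 + 2x <= 2x q^s], which follows from [2x <= 1], true as
   [s > 0], and [1 <= x q^s]. *)
have e1 : (1 + qR ^+ s) * (1 + 4 / 2 ^+ s.+1) <= qR ^+ s * (1 + 4 / 2 ^+ s).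
  have p2 : 0 < 2 ^+ s :> R by rewrite exprn_gt0.
  have h1 : 2 ^+ s <= qR ^+ s by rewrite lerXn2r ?nnegrE // card_field_ge2.
  have h2 : 2 <= 2 ^+ s :> R by rewrite -[leLHS]expr1 ler_weXn2l // ler1n.
  rewrite exprS invfM mulrA; have -> : 4 / 2 = 2 :> R by lra.
  set x := (2 ^+ s)^-1; have x0 : 0 < x by rewrite invr_gt0.
  have xs : x * 2 ^+ s = 1 by rewrite mulVf // gt_eqF.
  have xq : 1 <= x * qR ^+ s by rewrite -[leLHS]xs ler_wpM2l // ltW.
  have x2 : x * 2 <= 1 by rewrite -[leRHS]xs ler_wpM2l // ltW.
  rewrite -/x.
  have : 1 + 2 * x <= 2 * (x * qR ^+ s).
    by nra.
  by nra.
set b := base_mass k; have b0 : 0 <= b.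
  by apply: prodr_ge0 => i _; rewrite mulr_ge0 ?exprn_ge0.
have -> : qR ^+ (2 * k) * (qR - 1) * (1 + qR ^+ s) *
   ((1 + 4 / 2 ^+ s.+1) * qR ^+ (s.+1 * k) * b) =
   ((1 + qR ^+ s) * (1 + 4 / 2 ^+ s.+1)) *
   (qR ^+ (3 * k) * qR ^+ (s * k) * ((qR - 1) * b)).
  by rewrite !mulSn mul0n !addn0 !exprD; ring.
apply: le_trans (ler_wpM2r _ e1) _.
  by rewrite !mulr_ge0 ?exprn_ge0.
by rewrite mulnS exprD le_eqVlt; apply/orP; left; apply/eqP; ring.
Qed.

(** As [q - 1 >= 1], the base mass is at least [q^(3 * 'C(k, 2))], and [k^2 = 2 * 'C(k, 2) + k]. The
    excess over the [q^(k^2)] matrices is the source of the lower bound. *)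
Lemma base_mass_ge k : qR ^+ (k ^ 2 + 'C(k, 2)) <= base_mass k * qR ^+ k.
Proof.
have q1 : 1 <= qR - 1 by rewrite lerBrDr card_field_ge2.
elim: k => [|k IH]; first by rewrite /base_mass big_ord0 mulr1.
rewrite base_mass_rec.
have -> : (k.+1 ^ 2 + 'C(k.+1, 2) = (k ^ 2 + 'C(k, 2)) + (3 * k + 1))%N.
  by rewrite binS bin1; lia.
rewrite (exprD _ (k ^ 2 + _)) (exprD _ (3 * k)) expr1.
have -> : base_mass k * (qR ^+ (3 * k) * (qR - 1)) * qR ^+ k.+1 =
   (base_mass k * qR ^+ k) * (qR ^+ (3 * k) * qR * (qR - 1)) by rewrite exprS; ring.
apply: le_trans (_ : (base_mass k * qR ^+ k) * (qR ^+ (3 * k) * qR) <= _).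
  by rewrite ler_wpM2r ?mulr_ge0 ?exprn_ge0.
rewrite ler_wpM2l //; first by apply: le_trans IH; rewrite exprn_ge0.
by rewrite ler_peMr // mulr_ge0 ?exprn_ge0.
Qed.

(* In the support of the border a singular [Z] cannot be completed to an
   invertible matrix, so every bordering step contributes the value -1. *)
Lemma witness_sign k (Z : 'M[F]_k) :
  Z \in unitmx -> witness Z = (-1) ^+ k * `|witness Z|.
Proof.
elim: k Z => [|k IH] Z uZ; first by rewrite /= normr1 mulr1.
have [->|nz] := eqVneq (witness Z) 0; first by rewrite normr0 mulr0.
move: uZ nz; rewrite -[Z](@submxK _ 1 k 1 k).
move: (@ulsubmx _ 1 k 1 k Z) (@ursubmx _ 1 k 1 k Z)
  (@dlsubmx _ 1 k 1 k Z) (@drsubmx _ 1 k 1 k Z) => e d c {}Z uT nz.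
have dZ : (d <= Z)%MS.
  by apply: contraNT nz => dZ; rewrite [witness _]border_eq0.
have [X ZX] : exists X, Z *m X == c.
  apply/existsP; apply: contraNT nz; rewrite negb_exists => /forallP h.
  rewrite [witness _](@borderE R F 1 k) big_pred0 ?mulr0 // => X.
  exact/negbTE/h.
have /submxP[Y dE] := dZ; subst d; have /eqP cE := ZX; subst c.
have rT : (1 + k <= \rank (e - Y *m Z *m X)%R + \rank Z)%N.
  by rewrite -mxrank_schur row_leq_rank row_free_unit.
have r1 := rank_leq_row (e - Y *m Z *m X); have rZ := rank_leq_row Z.
have uZ : Z \in unitmx.
  rewrite -row_free_unit -row_leq_rank; apply: contraLR rT.
  by rewrite -!ltnNge => h; rewrite -addnS; exact: leq_add r1 h.
have ne : e != Y *m Z *m X.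
  rewrite -subr_eq0 -mxrank_eq0 -lt0n; apply: contraLR rT.
  by rewrite -!leqNgt leqn0 => /eqP ->; exact: rZ.
have wE : witness (block_mx e (Y *m Z) (Z *m X) Z) = witness Z * qR ^+ k * gap false.
  rewrite [LHS](@border_unitmx 1 k) // muln1 mulmxK // mulmxA.
  congr (_ * gap _); apply/negbTE; apply: contra ne => /eqP h; rewrite [e]mx11_scalar.
  by rewrite [Y *m Z *m X]mx11_scalar -!trace_mx11 h.
rewrite !wE !normrM gap_false {1}(IH _ uZ) (ger0_norm (exprn_ge0 _ _)) //.
by rewrite /gap mulr0 exprS; ring.
Qed.

(** The trace of the corner is equidistributed and [gap] has mean zero, so a constant may be
    subtracted from the acceptance probability. *)
Lemma sum_border l k (G : 'M[F]_k -> R) : \sum_(T : 'M[F]_(l.+1 + k)) border G T = 0.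
Proof.
rewrite (@sum_block_mx _ _ l.+1 k l.+1 k) exchange_big big1 // => d _.
rewrite exchange_big big1 // => c _.
rewrite exchange_big big1 // => Z _ /=.
under eq_bigr do rewrite borderE; rewrite -mulr_sumr exchange_big big1 ?mulr0 // => X _.
rewrite (sum_tr_eq l gap); apply/eqP.
suff : qR * \sum_(e : 'M[F]_l.+1) gap (\tr e == 0) == 0.
  by rewrite mulf_eq0 gt_eqF // (lt_le_trans _ card_field_ge2) // ltr0n.
rewrite mulr_natl -sumr_const; apply/eqP.
rewrite (eq_bigr _ (fun a _ => esym (sum_tr_eq l gap a))) exchange_big big1 // => e _.
exact: sum_gap.
Qed.

(** The correlation of the border with [a - 1/2] is bounded above by Fourier analysis. From below,
    every invertible [Z] contributes with the right sign, and the singular ones have too little mass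
    to cancel more than half of this. *)
Lemma witness_bound l k (a : 'M[F]_(l.+1 + k) -> 'M[F]_(l.+1 + k) -> R)
    (eps : R) (b : bool) c (chi : F -> R[i]) :
    {morph chi : u v / u + v >-> u * v} -> (forall u, `|chi u| = 1) ->
    \sum_u chi u = 0 ->
    gram_bounded a c -> (forall x y, 0 <= a x y <= 1) ->
    (forall x y, drsubmx (x + y) \in unitmx ->
       1 / 2 - eps <= (-1) ^+ (b (+) schur_zero (x + y)) * (a x y - 1 / 2)) ->
    4 / 2 ^+ l.+1 <= 1 / 2 - eps ->
  1 / 2 * (1 / 2 - eps) * qR ^+ 'C(k, 2) <= c%:R.
Proof.
move=> chiD chi1 chi_sum ga a01 hyp hl.
set eta := 1 / 2 - eps in hyp hl *.
have eta0 : 0 <= eta by apply: le_trans hl; rewrite divr_ge0 // exprn_ge0.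
pose H := border (l := l.+1) (@witness k).
pose N : R := (q ^ ((l.+1 + k) * (l.+1 + k)))%:R.
have q0 : 0 < qR by apply: lt_le_trans card_field_ge2; rewrite ltr0n.
have N0 : 0 < N by rewrite /N natrX exprn_gt0.
have flatH := flat_spectrum_border chiD chi1 chi_sum l
  (flat_spectrum_witness chiD chi1 chi_sum k).
have := flat_spectrum_gram chiD chi1 chi_sum flatH ga; rewrite -/H -/N => Sle.
have sumN (f : 'M[F]_(l.+1 + k) -> R) : \sum_x \sum_y f (x + y) = N * \sum_T f T.
  transitivity (\sum_(x : 'M[F]_(l.+1 + k)) \sum_T f T).
    apply: eq_bigr => x _; rewrite [RHS](reindex (fun y => x + y)) //.
    by exists (fun y => y - x) => y _; [rewrite addrC addKr | rewrite addrC subrK].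
  by rewrite sumr_const card_mx -mulr_natl.
have S_shift : \sum_x \sum_y H (x + y) * a x y =
    \sum_x \sum_y H (x + y) * (a x y - 1 / 2).
  apply/eqP; rewrite -subr_eq0 -sumrB.
  under eq_bigr do rewrite -sumrB.
  rewrite (eq_bigr (fun x => \sum_y H (x + y) * (1 / 2))); last first.
    by move=> x _; apply: eq_bigr => y _; ring.
  by rewrite (sumN (fun T => H T * (1 / 2))) -mulr_suml sum_border mul0r mulr0.
(* Where [Z] is invertible the advantage [eta] is guaranteed; elsewhere only [0 <= a <= 1] is known,
   so up to 1/2 may be lost. *)
pose wt (T : 'M[F]_(l.+1 + k)) : R :=
  if drsubmx T \in unitmx then eta * `|H T| else - (1 / 2) * `|H T|.
(* The factor [(-1) ^+ k] cancels the sign of the witness, and [~~ b] orients the test, [gap] being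
   positive exactly at [true]. *)
have pointwise x y : wt (x + y) <=
    (-1) ^+ (k + ~~ b) * (H (x + y) * (a x y - 1 / 2)).
  rewrite /wt; case: ifP => uZ; last first.
    rewrite mulNr lerNl; apply: le_trans (ler_norm _) _.
    rewrite normrN normrM normrX normrN1 expr1n [leLHS]mul1r (normrM (H _)).
    rewrite [leLHS]mulrC ler_wpM2r //.
    by rewrite ler_norml; have /andP[] := a01 x y; lra.
  have := hyp x y uZ; rewrite /H -(submxK (x + y)) border_unitmx //.
  rewrite /schur_zero !block_mxKul !block_mxKur !block_mxKdl !block_mxKdr.
  set w := witness _; set g := _ == _ => hg.
  have gE : gap g = - (-1) ^+ g * `|gap g|.
    by case: (g); rewrite ?gap_true ?gap_false /gap ?mulr1 ?mulr0 /= ?expr0 ?expr1; ring.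
  have -> : `|w * qR ^+ (k * l.+1) * gap g| = `|w| * qR ^+ (k * l.+1) * `|gap g|.
    by rewrite !normrM (ger0_norm (exprn_ge0 _ _)).
  have -> : w * qR ^+ (k * l.+1) * gap g =
      (-1) ^+ k * `|w| * qR ^+ (k * l.+1) * (- (-1) ^+ g * `|gap g|).
    by rewrite -gE -(witness_sign uZ).
  have -> : (-1) ^+ (k + ~~ b) * ((-1) ^+ k * `|w| * qR ^+ (k * l.+1) *
      (- (-1) ^+ g * `|gap g|) * (a x y - 1 / 2)) =
     ((-1) ^+ (b (+) g) * (a x y - 1 / 2)) * (`|w| * qR ^+ (k * l.+1) * `|gap g|).
    rewrite exprD; have : ((-1) ^+ k * (-1) ^+ k = 1 :> R) by rewrite -expr2 sqrr_sign.
    move: ((-1) ^+ k) => s ss.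
    transitivity ((s * s) * ((-1) ^+ (b (+) g) * (a x y - 1 / 2) *
      (`|w| * qR ^+ (k * l.+1) * `|gap g|))); last by rewrite ss [LHS]mul1r.
    by case: b {hg hyp}; case: (g); rewrite /= ?expr0 ?expr1; ring.
  by rewrite ler_wpM2r // !mulr_ge0 ?exprn_ge0.
have lower : N * \sum_T wt T <= N ^+ 2 * c%:R.
  apply: le_trans Sle; rewrite -sumN S_shift.
  set S := (X in _ <= `|X|).
  apply: le_trans (_ : (-1) ^+ (k + ~~ b) * S <= _).
    rewrite mulr_sumr; apply: ler_sum => x _.
    by rewrite mulr_sumr; apply: ler_sum => y _.
  apply: le_trans (ler_norm _) _.
  by rewrite normrM normrX normrN1 expr1n mul1r.
rewrite expr2 -mulrA ler_pM2l // in lower.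
pose Q := qR ^+ (k * l.+1).
pose E := gap_mass l.+1.
have E0 : 0 <= E by apply: le_trans (gap_mass_ge _).
pose U := unit_mass k.
have BU : base_mass k <= U := unit_mass_ge k.
(* For invertible [Z] the weight [q^(l.+1 * \rank Z)] equals [Q], so [rank_mass l.+1 k - Q * U] is
   the weighted mass of the singular [Z]. *)
have wtE : Q ^+ 2 * E *
    (eta * (Q * U) - 1 / 2 * (rank_mass l.+1 k - Q * U)) <= \sum_T wt T.
  have -> : \sum_T wt T = \sum_(Z : 'M[F]_k) (if Z \in unitmx then eta else - (1 / 2)) *
      \sum_e \sum_d \sum_c `|H (block_mx e d c Z)|.
    rewrite (@sum_block_mx _ _ l.+1 k l.+1 k).
    under eq_bigr do under eq_bigr do rewrite exchange_big /=.
    under eq_bigr do rewrite exchange_big /=.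
    rewrite exchange_big; apply: eq_bigr => Z _ /=.
    rewrite mulr_sumr; apply: eq_bigr => e _.
    rewrite mulr_sumr; apply: eq_bigr => d _.
    rewrite mulr_sumr; apply: eq_bigr => c' _.
    by rewrite /wt block_mxKdr; case: ifP.
  have -> : Q ^+ 2 * E * (eta * (Q * U) - 1 / 2 * (rank_mass l.+1 k - Q * U)) =
      \sum_(Z : 'M[F]_k) (Q ^+ 2 * E * ((eta + 1 / 2) * Q *
        (if Z \in unitmx then `|witness Z| else 0)
        - 1 / 2 * (`|witness Z| * qR ^+ (l.+1 * \rank Z)))).
    rewrite -mulr_sumr sumrB -!mulr_sumr -big_mkcond -/(unit_mass k) -/U.
    by rewrite -/(rank_mass l.+1 k); ring.
  apply: ler_sum => Z _; case: ifP => uZ.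
    rewrite border_mass_unitmx // mxrank_unit // [(l.+1 * k)%N]mulnC -/Q -/E.
    by rewrite le_eqVlt; apply/orP; left; apply/eqP; field.
  rewrite mulr0 sub0r mulrN mulNr lerN2 mulrCA ler_wpM2l ?divr_ge0 //.
  apply: le_trans (border_mass_total _ _ _) _; rewrite -/Q -/E.
  by rewrite le_eqVlt; apply/orP; left; apply/eqP; ring.
have B0 : 0 <= base_mass k.
  apply: prodr_ge0 => i _; rewrite mulr_ge0 ?exprn_ge0 ?subr_ge0 //.
  by rewrite (le_trans _ card_field_ge2) // ler1n.
have Q0 : 0 < Q by rewrite exprn_gt0.
have RM : rank_mass l.+1 k <= (1 + eta) * (Q * U).
  apply: le_trans (rank_mass_le k (ltn0Sn l)) _.
  rewrite mulnC -/Q -mulrA; apply: ler_pM => //.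
  - by rewrite addr_ge0 // divr_ge0 // exprn_ge0.
  - by rewrite mulr_ge0 // ltW.
  - by rewrite lerD2l.
  by rewrite ler_wpM2l // ltW.
have QU : 1 / 2 * eta * (Q ^+ 3 * E * U) <= N * c%:R.
  apply: le_trans lower; apply: le_trans wtE.
  have -> : 1 / 2 * eta * (Q ^+ 3 * E * U) =
      Q ^+ 2 * E * (eta * (Q * U) - 1 / 2 * (eta * (Q * U))) by field.
  rewrite ler_wpM2l ?mulr_ge0 ?exprn_ge0 ?(ltW Q0) //.
  by lra.
(* The factor [q^k] missing in [base_mass_ge] is paid by one of the three factors [Q]; the other two
   and [E] account for the border's share of [N]. *)
have big : N * qR ^+ 'C(k, 2) <= Q ^+ 3 * E * U.
  have NE : N = Q ^+ 2 * (q ^ (l.+1 * l.+1))%:R * qR ^+ (k ^ 2).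
    rewrite /N /Q !natrX -exprM -!exprD; congr (_ ^+ _); lia.
  rewrite NE -mulrA -exprD.
  apply: le_trans (_ : Q ^+ 2 * E * (base_mass k * qR ^+ k) <= _).
    apply: ler_pM; rewrite ?mulr_ge0 ?exprn_ge0 ?(ltW Q0) //.
      by rewrite ler_wpM2l ?exprn_ge0 ?(ltW Q0) // gap_mass_ge.
    exact: base_mass_ge.
  have -> : Q ^+ 3 * E * U = Q ^+ 2 * E * (U * Q) by ring.
  rewrite ler_wpM2l ?mulr_ge0 ?exprn_ge0 ?(ltW Q0) //.
  apply: ler_pM; rewrite ?exprn_ge0 ?(ltW q0) //.
  by rewrite ler_weXn2l ?leq_pmulr // (le_trans _ card_field_ge2) // ler1n.
rewrite -(ler_pM2l N0); apply: le_trans QU.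
by rewrite mulrCA ler_wpM2l // mulr_ge0 // divr_ge0.
Qed.

End Mass.

(** * Embedding into the stacked problems *)

(** A root [z] of [1 + X + ... + X^(p-1)] satisfies [z^p = 1], so [a |-> z^a] is additive; its sum
    is the value of that polynomial at [z]. *)
Lemma exists_additive_char (R : realType) p : prime p ->
  exists chi : 'F_p -> R[i],
    [/\ {morph chi : a b / a + b >-> a * b}, forall a, `|chi a| = 1
      & \sum_a chi a = 0].
Proof.
move=> p_pr; have := Fp_cast p_pr; set p' := (Zp_trunc (pdiv p)).+2 => p'E.
have p'0 : (0 < p')%N by [].
pose f : {poly R[i]} := \poly_(i < p') 1.
have /closed_rootP[z] : size f != 1%N by rewrite size_poly_eq ?oner_eq0.
rewrite /root horner_poly; under eq_bigr do rewrite mul1r; move=> /eqP sz.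
have zp : z ^+ p' = 1.
  by apply/eqP; rewrite -subr_eq0 subrX1 sz mulr0 eqxx.
exists (fun a : 'F_p => z ^+ (a : 'I_p')); split=> [a b|a|] //.
- by rewrite -exprD -[RHS](expr_mod _ zp).
- have z1 : `|z| = 1.
    by apply/eqP; rewrite -(@pexpr_eq1 _ _ p') // -normrX zp normr1.
  by rewrite normrX z1 expr1n.
Qed.

Section Embedding.
Variables (F : fieldType) (l k s : nat).
Local Notation K := (k * l + s)%N.
Implicit Types T : 'M[F]_(l + k).

Lemma delta_mx_col0 n : delta_mx 0 0 = col_mx 1%:M 0 :> 'cV[F]_(1 + n).
Proof.
apply/colP => i; rewrite mxE andbT [RHS]mxE.
by case: splitP => j ij; rewrite mxE -val_eqE /= ij // ord1.
Qed.

(** The trace pairing as a row times a column turns [tr(d Z^-1 c)] into a scalar Schur term. *)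
Lemma mxvec_tr m n (d : 'M[F]_(m, n)) (X : 'M[F]_(n, m)) :
  mxvec d^T *m (mxvec X)^T = (\tr (d *m X))%:M.
Proof.
apply/rowP => i; rewrite ord1 !mxE eqxx mulr1n sum_mxvec_index exchange_big.
apply: eq_bigr => a _; rewrite mxE; apply: eq_bigr => b _.
by rewrite [(mxvec X)^T _ _]mxE !mxvecE mxE.
Qed.

Lemma lin_mulmx_unit (Z : 'M[F]_k) : Z \in unitmx ->
  (lin_mulmx Z : 'M_(k * l)) \in unitmx.
Proof.
move=> uZ; suff : lin_mulmx Z *m lin_mulmx (invmx Z) = 1%:M :> 'M[F]_(k * l).
  by case/mulmx1_unit.
apply/row_matrixP => i; rewrite !rowE mulmxA mulmx1.
by rewrite -[delta_mx _ _]vec_mxK !mul_vec_lin /= mulKmx.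
Qed.

(** [lin_mulmx] acts on row vectors, hence the transpose for acting on columns. The identity block
    of size [s] pads to a prescribed dimension. *)
Definition pivot_mx T : 'M[F]_K := block_mx (lin_mulmx (drsubmx T))^T 0 0 1%:M.
Definition pivot_col T : 'cV[F]_K := col_mx (mxvec (dlsubmx T))^T 0.
Definition pivot_row T : 'rV[F]_K := row_mx (mxvec (ursubmx T)^T) 0.

Definition lin_block T : 'M[F]_(1 + K) :=
  block_mx (\tr (ulsubmx T))%:M (pivot_row T) (pivot_col T)
    (block_mx (lin_mulmx (drsubmx T))^T 0 0 0).

(* The constant part of the affine map [schur_block]; Alice adds it to her share. *)
Definition pad_block : 'M[F]_(1 + K) := block_mx 0 0 0 (block_mx 0 0 0 1%:M).

Definition schur_block T := pad_block + lin_block T.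

Lemma schur_blockE T : schur_block T =
  block_mx (\tr (ulsubmx T))%:M (pivot_row T) (pivot_col T) (pivot_mx T).
Proof.
by rewrite /schur_block /pad_block /lin_block !add_block_mx !add0r !addr0.
Qed.

Lemma lin_blockD x y : lin_block (x + y) = lin_block x + lin_block y.
Proof.
rewrite /lin_block /pivot_row /pivot_col add_block_mx.
have -> : ulsubmx (x + y) = ulsubmx x + ulsubmx y by apply/matrixP => i j; rewrite !mxE.
have -> : ursubmx (x + y) = ursubmx x + ursubmx y by apply/matrixP => i j; rewrite !mxE.
have -> : dlsubmx (x + y) = dlsubmx x + dlsubmx y by apply/matrixP => i j; rewrite !mxE.
have -> : drsubmx (x + y) = drsubmx x + drsubmx y by apply/matrixP => i j; rewrite !mxE.
congr block_mx.
- by rewrite !raddfD.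
- by rewrite add_row_mx addr0 raddfD /= linearD.
- by rewrite add_col_mx addr0 linearD raddfD.
- by rewrite add_block_mx !addr0 linearD raddfD.
Qed.

Section Pivot.
Variable T : 'M[F]_(l + k).
Hypothesis uZ : drsubmx T \in unitmx.

Lemma pivot_mx_unit : pivot_mx T \in unitmx.
Proof.
by rewrite unitmxE det_ublock det1 mulr1 -unitmxE unitmx_tr lin_mulmx_unit.
Qed.

Definition pivot_sol : 'cV[F]_K :=
  col_mx (mxvec (invmx (drsubmx T) *m dlsubmx T))^T 0.

Lemma pivot_solP : pivot_mx T *m pivot_sol = pivot_col T.
Proof.
rewrite mul_block_col !mulmx0 mul0mx !addr0 -trmx_mul mul_vec_lin /=.
by rewrite mulKVmx.
Qed.

Lemma pivot_row_sol :
  pivot_row T *m pivot_sol = (\tr (ursubmx T *m invmx (drsubmx T) *m dlsubmx T))%:M.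
Proof. by rewrite mul_row_col mulmx0 addr0 mxvec_tr mulmxA. Qed.

(** The Schur complement of [pivot_mx T] is the scalar [tr e - tr(d Z^-1 c)]. *)
Lemma rank_schur_block : \rank (schur_block T) = (~~ schur_zero T + K)%N.
Proof.
rewrite schur_blockE -pivot_solP -{1}(mulmxKV pivot_mx_unit (pivot_row T)).
rewrite mxrank_schur mulmxKV ?pivot_mx_unit // pivot_row_sol.
rewrite (mxrank_unit pivot_mx_unit) rank_rV -raddfB /= -scalemx1.
by rewrite scaler_eq0 oner_eq0 orbF subr_eq0.
Qed.

(** The extra row and column make the matrix invertible even when [schur_block T] is not. With
    right-hand side [e_1] they force the second coordinate to be 1, and the first becomes minus the
    scalar Schur complement. *)
Definition system_mx : 'M[F]_(1 + (1 + K)) :=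
  block_mx 0 (row_mx 1%:M 0) (col_mx 1%:M 0) (schur_block T).

Lemma system_mx_unit : system_mx \in unitmx.
Proof.
rewrite -row_free_unit -kermx_eq0; set u := kermx _.
have : u *m system_mx = 0 by exact: mulmx_ker.
rewrite -[u]hsubmxK; set a := lsubmx u; rewrite -[rsubmx u]hsubmxK.
set b := lsubmx _; set v := rsubmx (rsubmx u).
rewrite /system_mx schur_blockE mul_row_block mulmx0 add0r mul_row_col.
rewrite !mulmx0 mulmx1 addr0 mul_mx_row mul_row_block mulmx1 mulmx0 add_row_mx add0r.
rewrite -[0]row_mx0 => /eq_row_mx[->].
rewrite -[0 in RHS]row_mx0 => /eq_row_mx[] h1; rewrite mul0mx add0r => h2.
have v0 : v = 0 by rewrite -(mulmxK pivot_mx_unit v) h2 mul0mx.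
by move: h1; rewrite v0 !mul0mx !addr0 => ->; rewrite !row_mx0.
Qed.

Lemma system_answerP :
  (exists t : 'cV[F]_(1 + (1 + K)), system_mx *m t = delta_mx 0 0 /\ t 0 0 = 0) <->
  schur_zero T.
Proof.
pose tau : F := \tr (ursubmx T *m invmx (drsubmx T) *m dlsubmx T) - \tr (ulsubmx T).
pose t0 : 'cV[F]_(1 + (1 + K)) := col_mx tau%:M (col_mx 1%:M (- pivot_sol)).
have t0P : system_mx *m t0 = delta_mx 0 0.
  rewrite /system_mx schur_blockE mul_block_col mul0mx add0r mul_row_col.
  rewrite mul_col_mx mul_block_col.
  rewrite !mul1mx !mul0mx !mulmx1 !mulmxN pivot_solP pivot_row_sol subrr addr0.
  by rewrite add_col_mx addr0 raddfB /= addrA subrK subrr col_mx0 delta_mx_col0.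
have t00 : t0 0 0 = tau.
  have -> : (0 : 'I_(1 + (1 + K))) = lshift (1 + K) 0 by apply/val_inj.
  by rewrite col_mxEu mxE eqxx.
rewrite /schur_zero eq_sym -subr_eq0 -/tau -t00; split=> [[t [tP /eqP]]|/eqP h].
  suff -> : t = t0 by [].
  by rewrite -(mulKmx system_mx_unit t) tP -t0P mulKmx // system_mx_unit.
by exists t0.
Qed.

End Pivot.
End Embedding.

(** * Stacked matrices whose elimination leaves a sum *)

Section Stack.
Variables (F : fieldType) (m : nat).
Implicit Types A B E : 'M[F]_m.+1.

Lemma rank_stack A B E : E \in unitmx ->
  \rank (stack (row_mx A 1%:M) (row_mx (E *m B) (- E))) = (\rank (A + B)%R + m.+1)%N.
Proof.
move=> uE.
have uNE : - E \in unitmx by rewrite -scaleN1r unitmxZ ?unitrN1.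
have YZ : - invmx E *m - E = 1%:M by rewrite mulmxN mulNmx opprK mulVmx.
have -> : stack (row_mx A 1%:M) (row_mx (E *m B) (- E)) =
    block_mx A (- invmx E *m - E) (- E *m - B) (- E).
  by rewrite YZ !(mulNmx, mulmxN) opprK.
by rewrite mxrank_schur YZ mul1mx opprK (mxrank_unit uNE).
Qed.

Lemma unitmx_stack A B E : E \in unitmx -> A + B \in unitmx ->
  stack (row_mx A 1%:M) (row_mx (E *m B) (- E)) \in unitmx.
Proof.
by move=> uE uAB; rewrite -row_free_unit /row_free rank_stack // mxrank_unit.
Qed.

(** Adding [E^-1] times the second block row to the first eliminates the lower half of the solution,
    which is recovered as [usubmx b - A *m t]. *)
Lemma linear_system_stack A B E (b : 'cV[F]_(m.+1 + m.+1)) : E \in unitmx ->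
  linear_system_answer b (row_mx A 1%:M) (row_mx (E *m B) (- E)) <->
  exists t : 'cV[F]_m.+1, (A + B) *m t = usubmx b + invmx E *m dsubmx b /\ t 0 0 = 0.
Proof.
move=> uE; split=> [[t [tP t0]]|[t [tP t0]]].
  exists (usubmx t); split; last by rewrite mxE.
  move: tP; rewrite -[t]vsubmxK -[b]vsubmxK /stack mul_col_mx !mul_row_col.
  rewrite !col_mxKu !col_mxKd => /eq_col_mx[<- <-].
  rewrite mulmxDr mulNmx mulmxN mulKmx // -mulmxA mulKmx // mul1mx mulmxDl.
  by rewrite addrACA subrr addr0.
exists (col_mx t (usubmx b - A *m t)); split; last first.
  by rewrite /first_idx col_mxEu; move: t0; congr (t _ _ = 0); apply/val_inj.
rewrite /stack mul_col_mx !mul_row_col mul1mx addrC subrK -[RHS]vsubmxK.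
congr col_mx; rewrite mulNmx mulmxBr opprB addrA -mulmxA -mulmxDr -mulmxDl [B + A]addrC.
by rewrite tP mulmxDr mulKVmx // addrC addKr.
Qed.

Lemma inverse_linear_system (x y : 'M[F]_(m.+1, m.+1 + m.+1)) :
  stack x y \in unitmx ->
  inverse_answer x y <-> linear_system_answer (delta_mx (first_idx m) 0) x y.
Proof.
move=> uz; have tE : invmx (stack x y) (first_idx m) (first_idx m) =
    (invmx (stack x y) *m (delta_mx (first_idx m) 0 : 'cV_(m.+1 + m.+1))) (first_idx m) 0.
  by rewrite -colE mxE.
split=> [h|[t [tP t0]]].
  exists (invmx (stack x y) *m delta_mx (first_idx m) 0).
  by rewrite mulKVmx // -tE.
by rewrite /inverse_answer tE -tP mulKmx.
Qed.

End Stack.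

Lemma exists_unitmx_delta (F : fieldType) n (b : 'cV[F]_n.+1) : b != 0 ->
  exists2 P : 'M[F]_n.+1, P \in unitmx & P *m delta_mx 0 0 = b.
Proof.
move=> b0; have rb : \rank b = 1%N.
  by apply/eqP; rewrite eqn_leq rank_leq_col lt0n mxrank_eq0.
have := mulmx_ebase b; rewrite rb [row_ebase b]mx11_scalar.
set r := row_ebase b 0 0; rewrite mul_mx_scalar => bE.
exists (r *: col_ebase b).
  rewrite unitmxZ ?col_ebase_unit //.
  by have := row_ebase_unit b; rewrite [row_ebase b]mx11_scalar unitmxE det_scalar1.
rewrite -scalemxAl -[RHS]bE; congr (_ *: (_ *m _)).
by apply/matrixP => i j; rewrite !mxE ord1 /= andbT; case: i => -[].
Qed.

(** Keeps the reduced right-hand side nonzero. If [u = - v], a transvection copies a nonzero entry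
    of [v] to another coordinate, which takes dimension at least two. *)
Lemma exists_unitmx_add_neq0 (F : fieldType) n (u v : 'cV[F]_n.+2) :
  (u != 0) || (v != 0) ->
  exists2 E : 'M[F]_n.+2, E \in unitmx & u + invmx E *m v != 0.
Proof.
move=> uv; have [uv0|uv0] := eqVneq (u + v) 0; last first.
  by exists 1%:M; rewrite ?unitmx1 // invmx1 mul1mx.
have v0 : v != 0.
  by apply: contraTneq uv => v0; move: uv0; rewrite v0 addr0 => ->; rewrite eqxx.
have [i [j]] := matrix0Pn _ v0; rewrite ord1 => vi.
pose k : 'I_n.+2 := if i == 0 then 1 else 0.
have ki : (i == k) = false by rewrite /k; case: (eqVneq i 0) => [->|/negPf].
pose D : 'M[F]_n.+2 := delta_mx k i.
have DD : (1%:M - D) *m (1%:M + D) = 1%:M.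
  by rewrite mulmxBl mul1mx mulmxDr mulmx1 mul_delta_mx_cond ki mulr0n addr0 addrK.
have [uD1 uD2] := mulmx1_unit DD.
exists (1%:M - D) => //.
have -> : invmx (1%:M - D) = 1%:M + D by rewrite -[RHS](mulKmx uD1) DD mulmx1.
rewrite mulmxDl mul1mx addrA uv0 add0r.
apply/matrix0Pn; exists k, 0.
rewrite mxE (bigD1 i) //= big1 ?addr0 => [|r /negPf ri].
  by rewrite mxE !eqxx mul1r.
by rewrite mxE ri andbF mul0r.
Qed.

(** * Transfer of the lower bound to the three problems *)

Section Reduction.
Variables (R : realType) (p : nat).
Hypothesis p_pr : prime p.
Variable eps : R.

(** Locally computed inputs [f x], [g y] turn a protocol into one for the additive problem; the
    promise has to hold only where [Z] is invertible. *)
Lemma solves_cost (X Y : Type) (P : protocol R X Y) (promise answer : X -> Y -> Prop)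
    l k (f : 'M['F_p]_(l.+1 + k) -> X) (g : 'M['F_p]_(l.+1 + k) -> Y) (b : bool) :
    solves eps P promise answer ->
    (forall x y, drsubmx (x + y) \in unitmx ->
      promise (f x) (g y) /\ (answer (f x) (g y) <-> schur_zero (x + y) = b)) ->
    4 / 2 ^+ l.+1 <= 1 / 2 - eps ->
  1 / 2 * (1 / 2 - eps) * p%:R ^+ 'C(k, 2) <= (4 ^ cost P)%:R.
Proof.
move=> hP fg hl; have [chi [chiD chi1 chi_sum]] := exists_additive_char R p_pr.
rewrite -[in p%:R](card_Fp p_pr).
apply: (witness_bound (a := fun x y => accept_prob P (f x) (g y)) (b := b)
  chiD chi1 chi_sum _ _ _ hl) => [|x y|x y uZ].
- have [J [u [v [hu hv huv]]]] := accept_prob_gram_bounded P.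
  exists J, (fun x => u (f x)), (fun y => v (g y)); split=> // x y.
- exact: accept_prob_bounds.
have [/hP[h1 h2] ans] := fg x y uZ.
case: (eqVneq (schur_zero (x + y)) b) => [e|ne].
  by have := h1 (ans.2 e); rewrite e addbb expr0 mul1r; lra.
have /h2 : ~ answer (f x) (g y) by move=> /ans e; rewrite e eqxx in ne.
have -> : b (+) schur_zero (x + y) = true.
  by move: ne; case: b {fg ans}; case: schur_zero.
by rewrite /= expr1; lra.
Qed.

Variables (k l s : nat).
Local Notation K := (k * l.+1 + s)%N.
Local Notation n := (K.+2 + K.+2)%N.
Hypothesis hl : 4 / 2 ^+ l.+1 <= 1 / 2 - eps.

Lemma rank_cost (P : protocol R 'M['F_p]_(K.+2, n) 'M['F_p]_(K.+2, n)) :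
  solves eps P (@rank_promise 'F_p K.+1) (@rank_answer 'F_p K.+1) ->
  1 / 2 * (1 / 2 - eps) * p%:R ^+ 'C(k, 2) <= (4 ^ cost P)%:R.
Proof.
move=> hP.
(* The leading 1 brings the block to the size of [system_mx], so that all three problems share the
   same [n]. *)
pose f (x : 'M['F_p]_(l.+1 + k)) : 'M['F_p]_(K.+2, n) :=
  row_mx (block_mx 1%:M 0 0 (pad_block _ l.+1 k s + lin_block s x) : 'M_(1 + (1 + K)))
    1%:M.
pose g (y : 'M['F_p]_(l.+1 + k)) : 'M['F_p]_(K.+2, n) :=
  row_mx (1%:M *m (block_mx 0 0 0 (lin_block s y) : 'M_(1 + (1 + K)))) (- 1%:M).
apply: (solves_cost (f := f) (g := g) (b := false) hP) => // x y uZ.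
have sumE : (block_mx 1%:M 0 0 (pad_block _ l.+1 k s + lin_block s x) : 'M_(1 + (1 + K)))
    + block_mx 0 0 0 (lin_block s y) = block_mx 1%:M 0 0 (schur_block s (x + y)).
  by rewrite [LHS]add_block_mx !addr0 -addrA -lin_blockD.
have rk : \rank (stack (f x) (g y)) = (~~ schur_zero (x + y) + n.-1)%N.
  rewrite (@rank_stack _ K.+1) ?unitmx1 // sumE.
  rewrite (@rank_diag_block_mx _ 1 1) mxrank1 rank_schur_block //.
  by rewrite /= ; lia.
rewrite /rank_promise /rank_answer rk; case: schur_zero => /=.
  by split; [left | split=> [/eqP|//]; rewrite eq_sym; lia].
by split; [right | split].
Qed.

Lemma linear_system_cost (b : 'cV['F_p]_n)
    (P : protocol R 'M['F_p]_(K.+2, n) 'M['F_p]_(K.+2, n)) : b != 0 ->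
  solves eps P (@invertible_promise 'F_p K.+1) (@linear_system_answer 'F_p K.+1 b) ->
  1 / 2 * (1 / 2 - eps) * p%:R ^+ 'C(k, 2) <= (4 ^ cost P)%:R.
Proof.
move=> b0 hP.
have [E uE b'0] : exists2 E : 'M['F_p]_K.+2, E \in unitmx &
    usubmx b + invmx E *m dsubmx b != 0.
  apply: exists_unitmx_add_neq0; apply: contraNT b0.
  by rewrite negb_or !negbK -{3}[b]vsubmxK => /andP[/eqP-> /eqP->]; rewrite col_mx0.
(* Left multiplication by [U] carries [e_1] to the reduced right-hand side and does not change the
   solution. *)
have [U uU Ub] := exists_unitmx_delta b'0.
pose f (x : 'M['F_p]_(l.+1 + k)) : 'M['F_p]_(K.+2, n) :=
  row_mx (U *m (system_mx s x : 'M_(1 + (1 + K)))) 1%:M.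
pose g (y : 'M['F_p]_(l.+1 + k)) : 'M['F_p]_(K.+2, n) :=
  row_mx (E *m (U *m (block_mx 0 0 0 (lin_block s y) : 'M_(1 + (1 + K))))) (- E).
have sumE x y : (system_mx s x : 'M_(1 + (1 + K))) + block_mx 0 0 0 (lin_block s y) =
    system_mx s (x + y).
  by rewrite /system_mx [LHS]add_block_mx !addr0 /schur_block -addrA -lin_blockD.
have fg x y : U *m (system_mx s x : 'M_(1 + (1 + K))) +
    U *m (block_mx 0 0 0 (lin_block s y) : 'M_(1 + (1 + K))) =
    U *m (system_mx s (x + y)).
  by rewrite -mulmxDr sumE.
apply: (solves_cost (f := f) (g := g) (b := true) hP) => // x y uZ; split.
  apply: (@unitmx_stack _ K.+1) => //.
  by rewrite fg unitmx_mul uU system_mx_unit.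
apply: (iff_trans (@linear_system_stack _ K.+1 _ _ _ _ uE)).
apply: (iff_trans _ (system_answerP s uZ)); rewrite fg -Ub.
split=> -[t [tP t0]]; exists t; split=> //.
  by move: tP; rewrite -mulmxA => /(can_inj (mulKmx uU)).
by rewrite -mulmxA tP.
Qed.

Lemma inverse_cost (P : protocol R 'M['F_p]_(K.+2, n) 'M['F_p]_(K.+2, n)) :
  solves eps P (@invertible_promise 'F_p K.+1) (@inverse_answer 'F_p K.+1) ->
  1 / 2 * (1 / 2 - eps) * p%:R ^+ 'C(k, 2) <= (4 ^ cost P)%:R.
Proof.
move=> hP; apply: (@linear_system_cost (delta_mx (first_idx K.+1) 0)).
  apply/matrix0Pn; exists (first_idx K.+1), 0.
  by rewrite mxE !eqxx oner_eq0.
move=> x y prom; have [h1 h2] := hP x y prom.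
have := inverse_linear_system prom => -[i1 i2].
by split=> [/i2/h1|h] //; apply: h2 => /i1.
Qed.

End Reduction.

(** * From powers of [p] to the rate *)

Section Asymptotics.
Variable R : realType.

Lemma exists_exp_le (eta : R) : 0 < eta -> exists l : nat, 4 / 2 ^+ l.+1 <= eta.
Proof.
move=> eta0; have h0 : 0 <= 4 / eta by rewrite divr_ge0 // ltW.
exists (Num.bound (4 / eta)); set l := Num.bound _.
have h1 : 4 / eta < l%:R := archi_boundP h0.
rewrite ler_pdivrMr ?exprn_gt0 // mulrC -ler_pdivrMr //.
apply: le_trans (ltW h1) _; rewrite -natrX ler_nat.
by rewrite (leq_trans (ltnW (ltn_expl l (ltnSn 1)))) // leq_exp2l.
Qed.

(* From [p ^ 'C(k, 2) <= 2 ^ (l + 2 * cost)], [2 * l <= 'C(k, 2)] and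
   [n ^ 2 <= 64 * 'C(k, 2) * l.+2 ^ 2]. *)
Definition rate l : R := (256 * (l.+2%:R) ^+ 2 * ln 2)^-1.

Lemma ln2_gt0 : 0 < ln 2 :> R.
Proof. by rewrite ln_gt0 // ltr1n. Qed.

Lemma rate_gt0 l : 0 < rate l.
Proof. by rewrite invr_gt0 !mulr_gt0 // ?exprn_gt0 // ln2_gt0. Qed.

Lemma cost_rate (eta : R) p k l s c : (1 < p)%N -> (2 * l + 3 <= k)%N -> (s <= l)%N ->
    4 / 2 ^+ l.+1 <= eta ->
    1 / 2 * eta * p%:R ^+ 'C(k, 2) <= (4 ^ c)%:R ->
  rate l * ((k * l.+1 + s).+2 + (k * l.+1 + s).+2)%:R ^+ 2 * ln p%:R <= c%:R.
Proof.
move=> p1 hk hs heta hc; have L0 := ln2_gt0.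
have p0 : 0 < p%:R :> R by rewrite ltr0n (ltn_trans _ p1).
have Lp : ln 2 <= ln p%:R :> R by rewrite ler_ln ?posrE // ler_nat.
(* Since [4 / 2^(l+1) <= eta], the prefactor [eta / 2] is at least [2^-l]. *)
have powers : p%:R ^+ 'C(k, 2) <= 2 ^+ (l + 2 * c) :> R.
  rewrite exprD exprM.
  have -> : (2 ^+ 2) ^+ c = (4 ^ c)%:R :> R by rewrite !natrX -natrX.
  apply: le_trans (ler_wpM2l _ hc); last by rewrite exprn_ge0.
  have l2 : 0 < 2 ^+ l :> R by rewrite exprn_gt0.
  have one : 1 <= 2 ^+ l * (1 / 2 * eta).
    have e : 2 ^+ l * (1 / 2 * (4 / 2 ^+ l.+1)) = 1 :> R.
      by rewrite exprS; field; rewrite gt_eqF.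
    rewrite -[leLHS]e; apply: ler_wpM2l; first exact: ltW.
    by apply: ler_wpM2l => //; rewrite divr_ge0.
  by rewrite mulrA; apply: ler_peMl one; rewrite exprn_ge0 // ltW.
have logs : ln p%:R * ('C(k, 2))%:R <= ln 2 * (l + 2 * c)%:R :> R.
  rewrite !mulr_natr -!lnXn // ler_ln ?posrE ?exprn_gt0 //.
have k2 : (2 * 'C(k, 2) = k * k.-1)%N by rewrite -mul_bin_diag bin1.
have C2l : (2 * l <= 'C(k, 2))%N by nia.
have Ck : (k.+1 ^ 2 <= 16 * 'C(k, 2))%N by nia.
have nk : ((k * l.+1 + s).+2 + (k * l.+1 + s).+2 <= 2 * k.+1 * l.+2)%N by nia.
set n := (_ + _)%N in nk *.
have n2 : (n ^ 2 <= 64 * 'C(k, 2) * l.+2 ^ 2)%N.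
  apply: leq_trans (_ : (2 * k.+1 * l.+2) ^ 2 <= _)%N; first by rewrite leq_sqr.
  by rewrite !expnMn; nia.
have n2R : n%:R ^+ 2 <= 64 * 'C(k, 2)%:R * l.+2%:R ^+ 2 :> R.
  by rewrite -!natrX -!natrM ler_nat.
(* Half of the main term absorbs the additive [l]. *)
have LpC : ln 2 * l%:R <= ln p%:R * ('C(k, 2)%:R / 2) :> R.
  apply: ler_pM => //; first exact: ltW.
  by rewrite ler_pdivlMr // mulrC -natrM ler_nat.
have main : ln p%:R * 'C(k, 2)%:R <= 4 * ln 2 * c%:R :> R.
  by move: logs; rewrite natrD natrM; lra.
rewrite /rate -mulrA ler_pdivrMl; last first.
  by rewrite !mulr_gt0 // ?exprn_gt0.
apply: le_trans (ler_wpM2r (ltW (lt_le_trans L0 Lp)) n2R) _.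
have -> : 64 * 'C(k, 2)%:R * l.+2%:R ^+ 2 * ln p%:R =
  64 * l.+2%:R ^+ 2 * (ln p%:R * 'C(k, 2)%:R) :> R by ring.
have -> : 256 * l.+2%:R ^+ 2 * ln 2 * c%:R =
  64 * l.+2%:R ^+ 2 * (4 * ln 2 * c%:R) :> R by ring.
by rewrite ler_wpM2l // mulr_ge0 ?exprn_ge0.
Qed.

End Asymptotics.

Theorem theoremC1 (R : realType) (eps : R) (heps0 : 0 <= eps)
    (heps : eps < 1 / 2) :
  exists (c : R) (n0 : nat), 0 < c /\
    forall (p m : nat), prime p -> (n0 <= m.+1 + m.+1)%N ->
      let n := (m.+1 + m.+1)%N in
      let lower_bound (promise answer :
            'M['F_p]_(m.+1, n) -> 'M['F_p]_(m.+1, n) -> Prop) :=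
        forall P : protocol R 'M['F_p]_(m.+1, n) 'M['F_p]_(m.+1, n),
          solves eps P promise answer ->
          c * n%:R ^+ 2 * ln p%:R <= (cost P)%:R in
      [/\ lower_bound (@rank_promise 'F_p m) (@rank_answer 'F_p m),
          lower_bound (@invertible_promise 'F_p m) (@inverse_answer 'F_p m)
        & forall b : 'cV['F_p]_n, b != 0 ->
            lower_bound (@invertible_promise 'F_p m)
              (@linear_system_answer 'F_p m b)].
Proof.
have [l hl] := @exists_exp_le R (1 / 2 - eps) ltac:(by rewrite subr_gt0).
(* Here [l] depends on [eps] only. As [n = 2 * K.+2], the threshold gives
   [(2 * l + 3) * l.+1 <= K]. *)
exists (rate R l), (2 * ((2 * l + 3) * l.+1 + 2))%N; split; first exact: rate_gt0.
move=> p m p_pr.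
case: m => [|K]; first by lia.
move=> hn; have hk : (2 * l + 3 <= K %/ l.+1)%N by rewrite leq_divRL //; lia.
have hs : (K %% l.+1 <= l)%N by rewrite -ltnS ltn_mod.
(* In [K = k * l.+1 + s], the quotient [k] is the size of [Z], [l.+1] the width of the last border,
   and the remainder [s] the padding. *)
move: hk hs (divn_eq K l.+1) => + + KE; rewrite {hn}.
move: (K %/ l.+1)%N (K %% l.+1)%N KE => k s -> hk hs n lower_bound.
have p1 := prime_gt1 p_pr.
split=> [P|P|b b0 P] hP; apply: (cost_rate p1 hk hs hl).
- exact: rank_cost hP.
- exact: inverse_cost hP.
- exact: linear_system_cost b0 hP.
Qed.
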